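(* Let $d$ be a positive integer and $u_0\in\mathcal V(d)$, and let $u$ be the solution of the cubic Szeg\H{o} equation $i\partial_t u=\Pi(|u|^2u)$ with $u(0)=u_0$. Then the map $t\in\mathbb R\mapsto u(t)\in\mathcal V(d)$ is quasiperiodic: there exist a positive integer $n$, real numbers $\omega_1,\dots,\omega_n$, and a smooth map $\Phi:\mathbb T^n\to\mathcal V(d)$ such that $u(t)=\Phi(\omega_1t,\dots,\omega_nt)$ for every $t\in\mathbb R$. In particular, for every $s>\frac12$, $\sup_{t\in\mathbb R}\|u(t)\|_{H^s}<+\infty$.
   Context: $\mathbb T=\mathbb R/2\pi\mathbb Z$; $L^2_+(\mathbb T)$ is the subspace of $L^2(\mathbb T)$ of functions with vanishing negative Fourier coefficients, $\Pi$ is the orthogonal projector $L^2\to L^2_+$, and $H^s_+=H^s(\mathbb T)\cap L^2_+$. For $u\in H^{1/2}_+$, $H_u(h)=\Pi(u\bar h)$ (antilinear on $L^2_+$), $S$ is multiplication by $e^{ix}$ and $K_u=H_uS$. $\mathcal V(d)$ is the set of $u\in H^{1/2}_+$ with $\operatorname{rk}H_u=[\frac{d+1}2]$ and $\operatorname{rk}K_u=[\frac d2]$ ($[\cdot]$ = integer part); it is a complex submanifold of $L^2_+$ of dimension $d$, consisting of the functions $u=A(e^{ix})/B(e^{ix})$ with $A,B$ coprime polynomials, $B$ without zeros in the closed unit disc, $B(0)=1$, and: if $d=2N$, $\deg A\le N-1$ and $\deg B=N$; if $d=2N+1$, $\deg A=N$ and $\deg B\le N$. The cubic Szeg\H{o}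 flow preserves $\mathcal V(d)$. *)

(* Defs.v *)
From HB Require Import structures.
From mathcomp Require Import all_boot all_order all_algebra.
From mathcomp Require Import all_classical all_reals all_analysis.
From mathcomp Require Import complex.
Set Implicit Arguments. Unset Strict Implicit. Unset Printing Implicit Defensive.
Import Order.TTheory GRing.Theory Num.Theory.
Import numFieldNormedType.Exports.
Local Open Scope ring_scope.

Section Szego.
Variable R : realType.
Local Notation C := R[i].

(* An element of L^2_+(T) is represented by its sequence of (nonnegative)
   Fourier coefficients u : nat -> C, i.e. u(x) = sum_k u k e^{ikx}. *)

(* (A,B) is a representation of u in V(d):  u = A(e^{ix})/B(e^{ix}), i.e. the
   coefficients of u are those of the power series A(z)/B(z); since B(0) = 1
   this is the convolution identity B * u = A coefficientwise. *)
Definition Vd_repr (d : nat) (A B : {poly C}) (u : nat -> C) : Prop :=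
  [/\ coprimep A B, B`_0 = 1,
      (forall z : C, ComplexField.Normc.normc z <= 1 -> B.[z] != 0),
      (if odd d then size A = (d./2).+1 /\ (size B <= (d./2).+1)%N
                else (size A <= d./2)%N /\ size B = (d./2).+1) &
      forall k : nat, \sum_(j < k.+1) B`_j * u (k - j)%N = A`_k].

Definition inVd (d : nat) (u : nat -> C) : Prop :=
  exists A B : {poly C}, Vd_repr d A B u.

Definition l2dist2 (f g : nat -> C) : \bar R :=
  (\sum_(0 <= k <oo) ((ComplexField.Normc.normc (f k - g k)) ^+ 2)%:E)%E.

Definition Hs_norm2 (s : R) (f : nat -> C) : \bar R :=
  (\sum_(0 <= k <oo) (((1 + (k%:R) ^+ 2) `^ s) * (ComplexField.Normc.normc (f k)) ^+ 2)%:E)%E.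

(* k-th Fourier coefficient of Pi(|u|^2 u) = sum_{k1 - k2 + k3 = k} u_k1 conj(u_k2) u_k3 *)
Definition szego_nl_partial (u : nat -> C) (k N : nat) : C :=
  \sum_(0 <= k2 < N) \sum_(k1 < (k + k2).+1) u k1 * (u k2)^* * u (k + k2 - k1)%N.

(* the complex series (absolutely convergent for u in V(d)) is summed through
   its real and imaginary parts, since R[i] carries no topology instance *)
Definition szego_nl (u : nat -> C) (k : nat) : C :=
  Complex (limn (fun N : nat => complex.Re (szego_nl_partial u k N)))
          (limn (fun N : nat => complex.Im (szego_nl_partial u k N))).

Definition szego_solution (u : R -> nat -> C) : Prop :=
  forall (t e : R), 0 < e -> exists2 delta : R, 0 < delta &
    forall h : R, h != 0 -> `|h| < delta ->
      (l2dist2 (fun k => (u (t + h) k - u t k) / (h%:C)%C)%R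
               (fun k => - 'i * szego_nl (u t) k)%R < e%:E)%E.

Fixpoint smooth_n (n : nat) (k : nat) (f : 'rV[R]_n -> R) : Prop :=
  match k with
  | 0 => continuous f
  | k'.+1 => (forall x v : 'rV[R]_n, derivable f x v) /\
             (forall v : 'rV[R]_n, smooth_n k' (fun x => 'D_v f x))
  end.

Definition smooth (n : nat) (f : 'rV[R]_n -> R) : Prop := forall k, smooth_n k f.

Definition smoothC (n : nat) (f : 'rV[R]_n -> C) : Prop :=
  smooth (fun x => complex.Re (f x)) /\ smooth (fun x => complex.Im (f x)).

(* Phi : R^n -> V(d) is 2pi-periodic in each variable (a map on T^n) and smooth
   as a map into the manifold V(d), in the coordinates (A, B) of V(d). *)
Definition smooth_torus_map_Vd (d n : nat) (Phi : 'rV[R]_n -> nat -> C) : Prop :=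
  (forall (theta : 'rV[R]_n) (j : 'I_n),
      Phi (theta + (2 * pi) *: delta_mx 0 j) = Phi theta) /\
  exists (A B : 'rV[R]_n -> {poly C}),
    (forall theta, Vd_repr d (A theta) (B theta) (Phi theta)) /\
    (forall k : nat, smoothC (fun theta => (A theta)`_k) /\
                     smoothC (fun theta => (B theta)`_k)).

End Szego.

(* Main.v *)
Require Import Defs.
From HB Require Import structures.
From mathcomp Require Import all_boot all_order all_algebra.
From mathcomp Require Import all_classical all_reals all_analysis.
From mathcomp Require Import complex perm.
From mathcomp Require Import zify ring lra.
Set Implicit Arguments. Unset Strict Implicit. Unset Printing Implicit Defensive.
Import Order.TTheory GRing.Theory Num.Theory.
Import numFieldNormedType.Exports.
Local Open Scope ring_scope.
Local Open Scope sesquilinear_scope.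

(** A function [u] in V(d) has a balanced realization [u_k = b T^k c^*] on C^M, with [M] the rank
    of the Hankel operator [H_u], such that [T T^* = 1 - c^* c] and [T^* P T = P - b^* b], where [P] and
    [Q = P - b^* b] are the matrices of [H_u^2] and [K_u^2].  If [U] and [V] are unitary functions of
    [P] and [Q], then [T V U] and [b U] satisfy the same two identities.  An eigenvector of [T V U]
    with a unimodular eigenvalue would provide one for [T], so that the rotated realization is stable
    and minimal and again represents an element of V(d).  Letting the phases of [U] and [V] vary over
    a torus gives [Phi], whose coordinates (A, B) are trigonometric polynomials.  For
    [U = exp (-i t P)] and [V = exp (i t Q)] the realization satisfies [b' = -i b P] and
    [T' = -i T b^* b], from which the equation for [u_k] follows after summing the series
    [1 = sum_l T^l c^* c T^*^l] and [P = sum_l T^*^l b^* b T^l].  Finally a solution with values in V(d)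
    is unique: on V(d) coordinatewise continuity yields locally uniform geometric decay of the Fourier
    coefficients, under which the nonlinearity is Lipschitz for the supremum norm of the
    coefficients.  The same decay, uniform on the compact torus, bounds the Sobolev norms. *)

(** * Moduli, matrix norms and geometric decay *)

(** The obstacle is stability. The two matrix identities survive the rotation by pure algebra, but
    they only make the rotated [T] a contraction, and a unimodular eigenvalue would put a zero of B
    on the unit circle. Its exclusion requires the rotations to act by scalars on eigenspaces, which
    is why angles are attached to eigenvalues and not to eigenvectors. Normalizing the observability
    Gramian to 1 leaves [P] and [c] fixed along the flow: only [T] and [b] move, and the
    frequencies, the eigenvalues of H_u^2 and K_u^2, are read off the initial datum. Operators on
    L^2_+ are replaced by two finite Hankel matrices, (u_(i+j)) and (u_(i+j+1)), of size rk H_u: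
    invertibility of the first controls coprimality and degrees, that of the second the parity of d.
    The solution is a datum of the theorem, so an explicit solution says nothing about it without
    uniqueness; the decay, uniform in time, that uniqueness needs comes from the continuous
    dependence of the matrix shifting Hankel rows. *)

Notation nc := (@ComplexField.Normc.normc _).

Section Normc.
Variable R : realType.
Implicit Types (x y z : R[i]).

Lemma nc_norm z : `|z| = (nc z)%:C%C.
Proof. by []. Qed.

Lemma nc_ge0 z : 0 <= nc z.
Proof. by case: z => a b; rewrite sqrtr_ge0. Qed.

Lemma nc_eq0 z : (nc z == 0) = (z == 0).
Proof.
apply/eqP/eqP => [/ComplexField.Normc.eq0_normc//|->].
exact: ComplexField.Normc.normc0.
Qed.

Lemma nc0 : nc (0 : R[i]) = 0.
Proof. exact: ComplexField.Normc.normc0. Qed.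

Lemma nc1 : nc (1 : R[i]) = 1.
Proof. exact: ComplexField.Normc.normc1. Qed.

Lemma ncM x y : nc (x * y) = nc x * nc y.
Proof. exact: ComplexField.Normc.normcM. Qed.

Lemma ncX x n : nc (x ^+ n) = nc x ^+ n.
Proof. by elim: n => [|n IH]; rewrite ?expr0 ?nc1// !exprS ncM IH. Qed.

Lemma ncN x : nc (- x) = nc x.
Proof. exact: normcN. Qed.

Lemma ncD x y : nc (x + y) <= nc x + nc y.
Proof. exact: le_normcD. Qed.

Lemma ncB x y : nc (x - y) <= nc x + nc y.
Proof. by rewrite (le_trans (ncD _ _))// ncN. Qed.

Lemma nc_conj z : nc z^* = nc z.
Proof.
apply: complexI; rewrite -!nc_norm; exact: norm_conjC.
Qed.

Lemma nc_sum I (r : seq I) (P : pred I) (F : I -> R[i]) :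
  nc (\sum_(i <- r | P i) F i) <= \sum_(i <- r | P i) nc (F i).
Proof.
elim/big_ind2 : _ => [|x1 x2 y1 y2 h1 h2|//]; first by rewrite nc0.
by rewrite (le_trans (ncD _ _))// lerD.
Qed.

Lemma nc_Re z : `|complex.Re z| <= nc z.
Proof. by rewrite -lecR -nc_norm normc_ge_Re. Qed.

Lemma nc_Im z : `|complex.Im z| <= nc z.
Proof.
case: z => a b; rewrite /= -sqrtr_sqr ler_sqrt ?addr_ge0 ?sqr_ge0//.
by rewrite lerDr sqr_ge0.
Qed.

Lemma nc_le_ReIm z : nc z <= `|complex.Re z| + `|complex.Im z|.
Proof.
case: z => a b /=; rewrite -(@ler_pXn2r _ 2) ?nnegrE ?sqrtr_ge0 ?addr_ge0//.
rewrite sqr_sqrtr ?addr_ge0 ?sqr_ge0// sqrrD !real_normK ?num_real//.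
by rewrite addrAC lerDl mulrn_wge0// mulr_ge0.
Qed.

End Normc.

Section MatrixNorm.
Variable R : realType.

Definition mxnc m n (A : 'M[R[i]]_(m, n)) : R := \sum_i \sum_j nc (A i j).

Lemma mxnc_ge0 m n (A : 'M[R[i]]_(m, n)) : 0 <= mxnc A.
Proof. by apply: sumr_ge0 => i _; apply: sumr_ge0 => j _; exact: nc_ge0. Qed.

Lemma mxnc_entry m n (A : 'M[R[i]]_(m, n)) i j : nc (A i j) <= mxnc A.
Proof.
rewrite /mxnc (bigD1 i)//= (bigD1 j)//= -addrA lerDl addr_ge0//.
  by apply: sumr_ge0 => k _; exact: nc_ge0.
by apply: sumr_ge0 => k _; apply: sumr_ge0 => l _; exact: nc_ge0.
Qed.

Lemma mxncM m n p (A : 'M[R[i]]_(m, n)) (B : 'M[R[i]]_(n, p)) :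
  mxnc (A *m B) <= mxnc A * mxnc B.
Proof.
rewrite /mxnc mulr_suml; apply: ler_sum => i _.
rewrite (@le_trans _ _ (\sum_(j < p) \sum_(k < n) nc (A i k) * nc (B k j)))//.
  apply: ler_sum => j _; rewrite mxE (le_trans (nc_sum _ _ _))//.
  by apply: ler_sum => k _; rewrite ncM.
rewrite exchange_big /= mulr_suml; apply: ler_sum => k _.
rewrite -mulr_sumr ler_wpM2l ?nc_ge0// (bigD1 k)//= lerDl.
by apply: sumr_ge0 => l _; apply: sumr_ge0 => j _; exact: nc_ge0.
Qed.

Lemma mxnc_adj m n (A : 'M[R[i]]_(m, n)) : mxnc (A ^t*) = mxnc A.
Proof.
rewrite /mxnc exchange_big /=; apply: eq_bigr => i _; apply: eq_bigr => j _.
by rewrite !mxE nc_conj.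
Qed.

Lemma mxnc0 m n : mxnc (0 : 'M[R[i]]_(m, n)) = 0.
Proof. by rewrite /mxnc big1// => i _; rewrite big1// => j _; rewrite mxE nc0. Qed.

Lemma mxnc_eq0 m n (A : 'M[R[i]]_(m, n)) : mxnc A <= 0 -> A = 0.
Proof.
move=> h; apply/matrixP => i j; rewrite mxE; apply/eqP.
by rewrite -nc_eq0 eq_le nc_ge0 andbT (le_trans (mxnc_entry A i j)).
Qed.

End MatrixNorm.

Section Geometric.
Variable R : realType.
Implicit Types (a b : nat -> R).

(** One-sided, since it is meant for moduli and norms. With the rate existentially quantified, sums
    and products need no common rate, and passages to the limit are replaced by [geodecay_le0]. *)
Definition geodecay a := exists K q : R,
  [/\ 0 <= K, 0 < q, q < 1 & forall n, a n <= K * q ^+ n].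

Lemma geodecay_le a b : (forall n, a n <= b n) -> geodecay b -> geodecay a.
Proof.
by move=> ab [K [q [K0 q0 q1 h]]]; exists K, q; split=> // n; rewrite (le_trans (ab n)).
Qed.

Lemma geodecay0 : geodecay (fun=> 0).
Proof. by exists 0, 2^-1; split; rewrite ?invr_gt0 ?invf_lt1 ?ltr1n// => n; rewrite mul0r. Qed.

Lemma geodecayD a b : geodecay a -> geodecay b -> geodecay (fun n => a n + b n).
Proof.
move=> [K [q [K0 q0 q1 h]]] [L [p [L0 p0 p1 g]]].
exists (K + L), (Num.max p q); split; rewrite ?addr_ge0 ?lt_max ?gt_max ?p0 ?q1 ?p1//.
have mono r (r0 : 0 < r) n : r <= Num.max p q -> r ^+ n <= Num.max p q ^+ n.
  by move=> rm; rewrite lerXn2r// nnegrE ?(ltW r0)// (le_trans (ltW r0)).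
move=> n; rewrite mulrDl lerD//.
- by rewrite (le_trans (h n))// ler_wpM2l// mono// le_max lexx orbT.
- by rewrite (le_trans (g n))// ler_wpM2l// mono// le_max lexx.
Qed.

Lemma geodecayZ c a : 0 <= c -> geodecay a -> geodecay (fun n => c * a n).
Proof.
move=> c0 [K [q [K0 q0 q1 h]]]; exists (c * K), q; split; rewrite ?mulr_ge0// => n.
by rewrite -mulrA ler_wpM2l.
Qed.

Lemma geodecay_sum I (r : seq I) (P : pred I) (F : I -> nat -> R) :
  (forall i, P i -> geodecay (F i)) -> geodecay (fun n => \sum_(i <- r | P i) F i n).
Proof.
move=> h; elim: r => [|i r IH].
  by apply: geodecay_le geodecay0 => n; rewrite big_nil.
case: (boolP (P i)) => Pi.
  by apply: geodecay_le (geodecayD (h i Pi) IH) => n; rewrite big_cons Pi.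
by apply: geodecay_le IH => n; rewrite big_cons (negbTE Pi).
Qed.

Lemma geodecay_bounded a : geodecay a -> exists2 K, 0 <= K & forall n, a n <= K.
Proof.
move=> [K [q [K0 q0 q1 h]]]; exists K => // n.
by rewrite (le_trans (h n))// ler_piMr// exprn_ile1// ltW.
Qed.

Lemma geodecayM a b : (forall n, 0 <= a n) -> (forall n, 0 <= b n) ->
  geodecay a -> geodecay b -> geodecay (fun n => a n * b n).
Proof.
move=> a0 b0 /geodecay_bounded[K K0 h] gb.
by apply: geodecay_le (geodecayZ K0 gb) => n; rewrite ler_wpM2r.
Qed.

Lemma geodecay_shift k a : geodecay a -> geodecay (fun n => a (n + k)%N).
Proof.
move=> [K [q [K0 q0 q1 h]]]; exists K, q; split=> // n.
by rewrite (le_trans (h _))// ler_wpM2l// ler_wiXn2l ?ltW// leq_addr.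
Qed.

Lemma geodecay_cvg0 a e : geodecay a -> 0 < e ->
  exists N, forall n, (N <= n)%N -> a n < e.
Proof.
move=> [K [q [K0 q0 q1 h]]] e0.
have : `|q| < 1 by rewrite gtr0_norm.
move=> /cvg_expr/cvgrPdist_lt/(_ (e / (K + 1))).
rewrite divr_gt0 ?ltr_wpDl// => /(_ isT)[N _ hN].
exists N => n /hN /=; rewrite sub0r normrN normrX (gtr0_norm q0).
rewrite ltr_pdivlMr ?ltr_wpDl// => hn.
rewrite (le_lt_trans (h n))// (le_lt_trans _ hn)// mulrC ler_wpM2l ?exprn_ge0 ?ltW//.
by rewrite ltrDl.
Qed.

Lemma geodecay_le0 a x : geodecay a -> (forall n, x <= a n) -> x <= 0.
Proof.
move=> ga h; rewrite leNgt; apply/negP => x0.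
have [N /(_ N (leqnn _))] := geodecay_cvg0 ga x0.
by rewrite ltNge h.
Qed.

Lemma geometric_sum_le (q : R) n : 0 <= q -> q < 1 -> \sum_(i < n) q ^+ i <= (1 - q)^-1.
Proof.
move=> q0 q1; have q1' : 0 < 1 - q by rewrite subr_gt0.
rewrite -(ler_pM2l q1') mulfV ?gt_eqF// -opprB mulNr -subrX1 opprB.
by rewrite gerBl exprn_ge0.
Qed.

(** Each power [q ^+ i] with [i <= n] is at least [q ^+ n], so the left side is below a partial
    geometric sum. *)
Lemma arith_geometric_le (q : R) n : 0 <= q -> q < 1 -> n.+1%:R * q ^+ n <= (1 - q)^-1.
Proof.
move=> q0 q1; rewrite (le_trans _ (geometric_sum_le n.+1 q0 q1))//.
rewrite mulr_natl -[X in _ *+ X](card_ord n.+1) -sumr_const; apply: ler_sum => i _.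
by rewrite ler_wiXn2l// ?ltW// -ltnS.
Qed.

Lemma geodecay_arith a b : geodecay a -> (forall n, b n <= n.+1%:R * a n) -> geodecay b.
Proof.
move=> [K [q [K0 q0 q1 h]]] hb.
(* With [q = p * p], one factor [p ^+ n] absorbs [n.+1] and the other keeps the decay. *)
pose p := Num.sqrt q.
have p0 : 0 < p by rewrite sqrtr_gt0.
have p1 : p < 1 by rewrite -sqrtr1 ltr_sqrt.
have qE : q = p * p by rewrite -expr2 sqr_sqrtr// ltW.
exists (K * (1 - p)^-1), p; split=> //.
  by rewrite mulr_ge0// invr_ge0 subr_ge0 ltW.
move=> n; rewrite (le_trans (hb n))// (le_trans (ler_wpM2l _ (h n)))//.
rewrite mulrCA -mulrA ler_wpM2l// qE exprMn mulrA ler_wpM2r ?exprn_ge0 ?(ltW p0)//.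
exact: arith_geometric_le (ltW p0) p1.
Qed.

End Geometric.

(** * Rational functions and Hankel matrices *)

Section Convolution.
Variable F : fieldType.
Implicit Types (p q A B : {poly F}) (u : nat -> F).

(** Coefficients of the product of [p] with the power series of coefficients [u]. Up to any given
    degree this is a product of polynomials, from which associativity follows. *)
Definition pconv p u k := \sum_(j < k.+1) p`_j * u (k - j)%N.

Lemma pconv_trunc p u k n : (k < n)%N -> pconv p u k = (p * \poly_(i < n) u i)`_k.
Proof.
move=> kn; rewrite coefM; apply: eq_bigr => j _; rewrite coef_poly.
by rewrite (leq_ltn_trans (leq_subr _ _) kn).
Qed.

Lemma pconv_mul p q u k : pconv (p * q) u k = pconv p (pconv q u) k.
Proof.
rewrite (@pconv_trunc _ _ _ k.+1)// -mulrA coefM; apply: eq_bigr => j _.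
by rewrite [in RHS](@pconv_trunc _ _ _ k.+1)// ltnS leq_subr.
Qed.

Lemma pconvZ c p u k : pconv (c *: p) u k = c * pconv p u k.
Proof. by rewrite /pconv mulr_sumr; apply: eq_bigr => j _; rewrite coefZ mulrA. Qed.

Lemma pconv_XsubC c u k : pconv ('X - c%:P) u k.+1 = u k - c * u k.+1.
Proof.
rewrite /pconv !big_ord_recl big1 => [|i _].
  by rewrite !coefB !coefX !coefC /= subr0 mul1r sub0r addr0 subn0 subSS subn0 mulNr addrC.
by rewrite coefB coefX coefC /= subrr mul0r.
Qed.

Lemma pconv_XsubC0 c u : pconv ('X - c%:P) u 0 = - c * u 0.
Proof. by rewrite /pconv big_ord1 coefB coefX coefC /= sub0r. Qed.

Lemma pconv_size p u M k : (size p <= M.+1)%N -> (M <= k)%N ->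
  pconv p u k = \sum_(j < M.+1) p`_j * u (k - j)%N.
Proof.
move=> sp Mk; rewrite /pconv.
rewrite -(big_mkord xpredT (fun j => p`_j * u (k - j)%N)).
rewrite (@big_cat_nat _ _ _ M.+1)//= [X in _ + X]big_nat_cond [X in _ + X]big1 ?addr0 ?big_mkord//.
by move=> j /andP[/andP[h _] _]; rewrite nth_default ?mul0r// (leq_trans sp).
Qed.

(** For [s = 0] and [s = 1] these are truncated matrices of H_u and K_u. *)
Definition hankel M u s : 'M[F]_M := \matrix_(i, j) u (i + j + s)%N.

Lemma unitmx_inj n (A : 'M[F]_n) :
  (forall v : 'rV_n, v *m A = 0 -> v = 0) -> A \in unitmx.
Proof. by move=> h; rewrite -row_free_unit; apply: inj_row_free. Qed.

Lemma unitmx_ker0 n (A : 'M[F]_n) (v : 'rV_n) : A \in unitmx -> v *m A = 0 -> v = 0.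
Proof. by move=> Au h; rewrite -[v](mulmxK Au) h mul0mx. Qed.

(* If [x Gamma = 0] then, with [X = sum_j x_j z^(M-1-j)], the coefficients of [X u] in degrees
   [M-1, ..., 2M-2] vanish, so that [X A - Y B] vanishes up to degree [2M-2] for some
   [Y] of degree at most [M-2], and therefore vanishes identically. *)
Lemma hankel_unit M u A B :
  coprimep A B -> (forall k, pconv B u k = A`_k) ->
  (size A <= M)%N -> (size B <= M.+1)%N -> size A = M \/ size B = M.+1 ->
  hankel M u 0 \in unitmx.
Proof.
move=> cAB hu sA sB sAB; apply: unitmx_inj => v vH.
case: M => [|M] in sA sB sAB v vH *; first by apply/rowP; case.
pose X := \poly_(i < M.+1) v 0 (inord (M - i)).
pose U := \poly_(i < M.*2.+1) u i.
pose Y := \poly_(i < M) (X * U)`_i.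
have sX : (size X <= M.+1)%N by exact: size_poly.
have sY : (size Y <= M)%N by exact: size_poly.
have XU k : (k < M.*2.+1)%N -> (X * U - Y)`_k = 0.
  move=> kM; rewrite coefB coef_poly; case: ltnP => Mk; rewrite ?subrr// subr0.
  rewrite coefM.
  transitivity (pconv X u k).
    apply: eq_bigr => j _; congr (_ * _).
    by rewrite coef_poly (leq_ltn_trans (leq_subr _ _) kM).
  rewrite (pconv_size _ sX); last exact: leq_trans Mk.
  have kM' : (k - M < M.+1)%N by lia.
  have /rowP/(_ (Ordinal kM')) := vH; rewrite !mxE => e; rewrite -[RHS]e {e}.
  rewrite (reindex_inj rev_ord_inj); apply: eq_bigr => j _; rewrite mxE /= coef_poly.
  have jM : (j <= M)%N by rewrite -ltnS.
  rewrite subSS ltnS leq_subr subKn//; congr (v 0 _ * u _); last by lia.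
  by apply: val_inj; rewrite /= inordK.
have XA : X * A = Y * B.
  apply/eqP; rewrite -subr_eq0; apply/eqP/polyP => k; rewrite coef0.
  have [kM|kM] := ltnP k M.*2.+1; last first.
    rewrite nth_default// (leq_trans (size_polyD _ _))// size_polyN geq_max.
    rewrite !(leq_trans (size_polyMleq _ _))//.
    - by move: sY sB; move: (size Y) (size B) => a b; lia.
    - by move: sX sA; move: (size X) (size A) => a b; lia.
  have -> : (X * A - Y * B)`_k = (B * (X * U - Y))`_k.
    rewrite mulrBr (mulrC Y) !coefB mulrCA; congr (_ - _).
    rewrite !coefM; apply: eq_bigr => j _; congr (_ * _).
    by rewrite -hu (@pconv_trunc _ _ _ M.*2.+1)// (leq_ltn_trans (leq_subr _ _) kM).
  by rewrite coefM big1// => j _; rewrite XU ?mulr0// (leq_ltn_trans (leq_subr _ _) kM).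
(* By coprimality [A] divides [Y] and [B] divides [X]; whichever of [A] and [B] has maximal size is
   too large to divide a nonzero polynomial of that size. *)
have X0 : X = 0.
  case: sAB => s.
  - have : A %| Y by rewrite -(Gauss_dvdpl _ cAB) -XA dvdp_mull.
    have [Y0 _|Y0 /(dvdp_leq Y0)] := eqVneq Y 0; last by rewrite s leqNgt ltnS sY.
    move/eqP: XA; rewrite Y0 mul0r mulf_eq0 => /orP[/eqP//|/eqP A0].
    by rewrite A0 size_poly0 in s.
  - have : B %| X by rewrite coprimep_sym in cAB; rewrite -(Gauss_dvdpl _ cAB) XA dvdp_mull.
    have [//|X0 /(dvdp_leq X0)] := eqVneq X 0; by rewrite s leqNgt ltnS sX.
apply/rowP => i; rewrite mxE; have /polyP/(_ (M - i)%N) := X0.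
have iM : (i <= M)%N by rewrite -ltnS.
rewrite coef_poly coef0 ltnS leq_subr subKn// => <-; congr (v 0 _).
by apply: val_inj; rewrite /= inordK.
Qed.

(** The reversed coefficients of [p] form a row vector in the left kernel of the Hankel matrix:
    invertibility means that [u] obeys no shorter recurrence. *)
Lemma hankel_unit_minimal M u p : hankel M u 0 \in unitmx -> (size p <= M)%N ->
  (forall k, (M.-1 <= k)%N -> pconv p u k = 0) -> p = 0.
Proof.
case: M => [|M] Hu sp hp; first by apply/eqP; rewrite -size_poly_leq0.
pose v : 'rV[F]_M.+1 := \row_i p`_(M - i).
suff v0 : v = 0.
  apply/polyP => k; rewrite coef0; have [kM|kM] := ltnP k M.+1; last first.
    by rewrite nth_default// (leq_trans sp).
  have /rowP/(_ (rev_ord (Ordinal kM))) := v0; rewrite !mxE /= subSS subKn//.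
apply: unitmx_ker0 Hu _; apply/rowP => j; rewrite !mxE.
rewrite -[RHS](hp (M + j)%N (leq_addr _ _)) (pconv_size _ sp) ?leq_addr//.
rewrite (reindex_inj rev_ord_inj); apply: eq_bigr => i _ /=; rewrite !mxE /=.
have iM : (i <= M)%N by rewrite -ltnS.
by rewrite subSS subKn// addn0; congr (_ * u _); lia.
Qed.

(** If the coefficient of index [M] vanishes, [B] is too short a recurrence for the shifted
    sequence, whose Hankel matrix therefore cannot be invertible. *)
Lemma hankel1_unit M u B : hankel M u 0 \in unitmx -> (size B <= M.+1)%N ->
  B`_0 = 1 -> (forall k, (M <= k)%N -> pconv B u k = 0) ->
  (hankel M u 1 \in unitmx) = (B`_M != 0) || (M == 0)%N.
Proof.
case: M => [|M] Hu sB B0 hB.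
  by rewrite eqxx orbT unitmx_inj// => v _; apply/rowP; case.
rewrite orbF; apply/idP/idP => [H1|BM].
  apply/negP => /eqP BM.
  have sB' : (size B <= M.+1)%N by apply/leq_sizeP => j; rewrite leq_eqVlt => /orP[/eqP<-//|]; move/leq_sizeP: sB; apply.
  have: B`_0 <> 0 by rewrite B0; apply/eqP; rewrite oner_eq0.
  apply; suff -> : B = 0 by rewrite coef0.
  apply: (@hankel_unit_minimal M.+1 (fun k => u k.+1)) => //.
    suff -> : hankel M.+1 (fun k => u k.+1) 0 = hankel M.+1 u 1 by [].
    by apply/matrixP => i j; rewrite !mxE addn0 addn1.
  move=> k Mk; rewrite (pconv_size _ sB')//= -[RHS](hB k.+1)// (pconv_size _ sB') ?leqW//.
  apply: eq_bigr => j _; congr (_ * u _); have := ltn_ord j; lia.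
(* For the converse, [f] obeys the recurrence of [B] and vanishes at 1, ..., [M.+1]. At the index
   [M.+1] only the top coefficient of [B] times [f 0] survives, so [f 0] vanishes too and [v] lies
   in the kernel of the unshifted matrix. *)
apply: unitmx_inj => v vH.
pose f k := \sum_(i < M.+1) v 0 i * u (i + k)%N.
have f0 k : (0 < k)%N -> (k <= M.+1)%N -> f k = 0.
  case: k => // k _ kM; have /rowP/(_ (Ordinal (kM : (k < M.+1)%N))) := vH.
  by rewrite !mxE => e; rewrite -[RHS]e {e}; apply: eq_bigr => i _; rewrite mxE addn1 addnS.
have fB : B`_M.+1 * f 0 = 0.
  have : \sum_(j < M.+2) B`_j * f (M.+1 - j)%N = 0.
    under eq_bigr do rewrite mulr_sumr; rewrite exchange_big /= big1// => i _.
    transitivity (v 0 i * pconv B u (i + M.+1)%N); last by rewrite hB ?mulr0// leq_addl.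
    rewrite (pconv_size _ sB) ?leq_addl// mulr_sumr; apply: eq_bigr => j _.
    by rewrite mulrCA; congr (_ * (_ * u _)); have := ltn_ord j; lia.
  rewrite big_ord_recr /= subnn big1 ?add0r// => j _.
  by rewrite f0 ?mulr0//; have := ltn_ord j; lia.
apply: unitmx_ker0 Hu _; apply/rowP => j; rewrite !mxE.
transitivity (f j); first by apply: eq_bigr => i _; rewrite !mxE addn0.
have [->|j0] := posnP j; last by rewrite f0// ltnW.
by move/eqP: fB; rewrite mulf_eq0 (negbTE BM) => /eqP.
Qed.

End Convolution.

Section CoprimeOfHankel.
Variable F : closedFieldType.
Implicit Types A B : {poly F}.

Lemma coprimep_hankel M u A B : hankel M u 0 \in unitmx ->
  (forall k, pconv B u k = A`_k) -> B`_0 = 1 -> (size A <= M)%N -> (size B <= M.+1)%N ->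
  coprimep A B.
Proof.
move=> Hu hu B0 sA sB; apply: contraT => /closed_rootP[z].
rewrite root_gcd => /andP[/factor_theorem[A' AE] /factor_theorem[B' BE]].
have nzB : B' != 0.
  by apply/eqP => B'0; move: B0; rewrite BE B'0 mul0r coef0 => /eqP; rewrite eq_sym oner_eq0.
have nz : z != 0.
  apply/eqP => z0; move: B0; rewrite BE z0 subr0 coefMX /= => /eqP.
  by rewrite eq_sym oner_eq0.
(* A common root [z] cancels from [B * u = A], leaving a recurrence of length [M]. *)
have h k : pconv B' u k = A'`_k.
  elim: k => [|k IH].
  - have := hu 0%N; rewrite AE BE mulrC pconv_mul pconv_XsubC0 coefM big_ord1 subnn.
    by rewrite coefB coefX coefC /= sub0r mulrC => /(mulIf _); apply; rewrite oppr_eq0.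
  - have := hu k.+1; rewrite AE BE mulrC pconv_mul pconv_XsubC IH mulrBr coefB coefMX coefMC /=.
    by move=> /addrI/oppr_inj; rewrite mulrC => /(mulIf nz).
have := size_Mmonic nzB (monicXsubC z); rewrite -BE size_XsubC addn2 /= => sBE.
suff B'0 : B' = 0 by rewrite B'0 eqxx in nzB.
apply: (hankel_unit_minimal Hu) => [|k kM]; first by rewrite -ltnS -sBE.
rewrite h nth_default//.
have [->|nzA] := eqVneq A' 0; first by rewrite size_poly0.
have := size_Mmonic nzA (monicXsubC z); rewrite -AE size_XsubC addn2 /=.
by move=> sAE; rewrite (leq_trans _ kM)// -ltnS -sAE (leq_trans sA)// leqSpred.
Qed.

(** If [A] were shorter as well, [B] would be a recurrence of length less than [M] holding already
    from the index [M - 1]. *)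
Lemma size_hankel M u A B : hankel M u 0 \in unitmx ->
  (forall k, pconv B u k = A`_k) -> B`_0 = 1 -> (size A <= M)%N -> (size B <= M)%N ->
  size A = M.
Proof.
move=> Hu hu B0 sA sB; apply/eqP; rewrite eqn_leq sA leqNgt; apply/negP => sA'.
suff B_0 : B = 0 by move: B0; rewrite B_0 coef0 => /eqP; rewrite eq_sym oner_eq0.
apply: (hankel_unit_minimal Hu sB) => k kM; rewrite hu nth_default// (leq_trans _ kM)//.
by rewrite -ltnS (leq_trans sA')// leqSpred.
Qed.

End CoprimeOfHankel.

(** * Geometric decay of the coefficients of a rational function *)

Section RationalDecay.
Variable R : realType.

Lemma geodecay_conv_XsubC (r : R[i]) (w : nat -> R[i]) : 1 < nc r ->
  geodecay (fun k => nc (pconv ('X - r%:P) w k)) -> geodecay (fun k => nc (w k)).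
Proof.
move=> r1 [K [q0 [K0 q00 q01 h]]].
have r0 : 0 < nc r by apply: lt_trans r1.
(* The rate must be at least [q0] and strictly above [(nc r)^-1], the rate of the homogeneous
   recurrence: hence the midpoint between [(nc r)^-1] and 1. *)
pose q := Num.max q0 (2^-1 * (1 + (nc r)^-1)).
have ri1 : (nc r)^-1 < 1 by rewrite invf_lt1.
have qq0 : q0 <= q by rewrite le_max lexx.
have qr : (nc r)^-1 < q by rewrite lt_max; apply/orP; right; lra.
have q1 : q < 1 by rewrite gt_max q01 /=; lra.
have q0p : 0 < q by apply: lt_le_trans qq0.
have h' k : nc (pconv ('X - r%:P) w k) <= K * q ^+ k.
  by rewrite (le_trans (h k))// ler_wpM2l// lerXn2r// nnegrE ltW.
have D0 : 0 < q * nc r - 1 by rewrite subr_gt0 -ltr_pdivrMr// mul1r.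
(* The solution of [L * (q * nc r) = L + K * q], the equation that closes the induction. *)
pose L := K * q / (q * nc r - 1).
have L0 : 0 <= L by exact: divr_ge0 (mulr_ge0 K0 (ltW q0p)) (ltW D0).
exists L, q; split=> //.
have LE : L * (q * nc r) = L + K * q.
  by rewrite -{1}(subrK 1 (q * nc r)) mulrDr mulr1 divfK ?gt_eqF// addrC.
elim=> [|k IH].
- have := h' 0%N; rewrite pconv_XsubC0 ncM ncN !expr0 !mulr1 => hk.
  rewrite -(ler_pM2l r0) (le_trans hk)// -(ler_pM2l q0p).
  have -> : q * (nc r * L) = L * (q * nc r) by ring.
  by rewrite LE mulrC lerDr.
- have := h' k.+1; rewrite pconv_XsubC => hk.
  rewrite -(ler_pM2l r0) -ncM.
  have -> : r * w k.+1 = w k - (w k - r * w k.+1) by ring.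
  rewrite (le_trans (ncB _ _))// (le_trans (lerD IH hk))//.
  have -> : nc r * (L * q ^+ k.+1) = L * (q * nc r) * q ^+ k by rewrite exprS; ring.
  by rewrite LE exprS; rewrite le_eqVlt; apply/orP; left; apply/eqP; ring.
Qed.

(** The roots of [B] lie outside the closed unit disc, and its linear factors are divided out one at
    a time, so that multiple roots need no separate treatment. *)
Lemma geodecay_conv (B : {poly R[i]}) (u : nat -> R[i]) :
  (forall z, nc z <= 1 -> B.[z] != 0) ->
  geodecay (fun k => nc (pconv B u k)) -> geodecay (fun k => nc (u k)).
Proof.
move=> hB; have [rs BE] := closed_field_poly_normal B.
have lB : lead_coef B != 0.
  rewrite lead_coef_eq0; apply/eqP => B0; have := hB 0.
  by rewrite nc0 ler01 B0 horner0 eqxx => /(_ isT).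
have hrs : all (fun r => 1 < nc r) rs.
  apply/allP => r rrs; rewrite ltNge; apply: contraT; rewrite negbK => /hB.
  rewrite BE hornerZ mulf_eq0 (negbTE lB) /= -/(root _ _) root_prod_XsubC rrs //.
rewrite BE => h.
have {h} : geodecay (fun k => nc (pconv (\prod_(r <- rs) ('X - r%:P)) u k)).
  have l0 : 0 <= (nc (lead_coef B))^-1 by rewrite invr_ge0 nc_ge0.
  by apply: geodecay_le (geodecayZ l0 h) => k; rewrite pconvZ ncM mulKf// nc_eq0.
elim: rs hrs {BE} u => [|r rs IH] /= => [_|/andP[r1 hrs]] u.
  by apply: geodecay_le => k; rewrite big_nil /pconv big_ord_recl big1 ?coef1 ?mul1r ?subn0 ?addr0// => i _; rewrite coef1 mul0r.
rewrite big_cons => h; apply: IH => //; apply: geodecay_conv_XsubC r1 _.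
by apply: geodecay_le h => k; rewrite -pconv_mul.
Qed.

End RationalDecay.

(** * V(d) in terms of Hankel matrices *)

Section Vd.
Variable R : realType.
Implicit Types (u : nat -> R[i]) (A B : {poly R[i]}).

(** [uphalf d] is [(d+1)/2], the rank of H_u. In this form the two parities of [d] are treated
    together. *)
Lemma Vd_size d A B u : Vd_repr d A B u ->
  [/\ (size A <= uphalf d)%N, (size B <= (uphalf d).+1)%N &
      size A = uphalf d \/ size B = (uphalf d).+1].
Proof.
rewrite uphalf_half; move=> [_ _ _ h _]; case: (odd d) h => -[h1 h2]; rewrite ?add1n ?add0n.
  by split; [rewrite h1|exact: leqW|left].
by split; [|rewrite h2|right].
Qed.

Lemma Vd_hankel d A B u : Vd_repr d A B u -> hankel (uphalf d) u 0 \in unitmx.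
Proof. by move=> h; have [sA sB sAB] := Vd_size h; case: h => cAB _ _ _ hu; exact: hankel_unit hu sA sB sAB. Qed.

Lemma Vd_recurrence d A B u k : Vd_repr d A B u -> (uphalf d <= k)%N -> pconv B u k = 0.
Proof.
move=> h; have [sA _ _] := Vd_size h; case: h => _ _ _ _ hu kd.
by rewrite /pconv hu nth_default// (leq_trans sA).
Qed.

Lemma Vd_geodecay d u : inVd d u -> geodecay (fun k => nc (u k)).
Proof.
move=> [A [B h]]; have [sA _ _] := Vd_size h; case: h => _ _ hB _ hu.
apply: (geodecay_conv hB).
(* [A] has finitely many coefficients, so any rate serves; the weights [2 ^+ i] compensate the rate
   1/2. *)
exists (\sum_(i < size A) nc A`_i * 2 ^+ i), 2^-1; split; rewrite ?invr_gt0 ?invf_lt1 ?ltr1n//.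
  by apply: sumr_ge0 => i _; rewrite mulr_ge0 ?nc_ge0.
move=> k; rewrite /pconv hu; have [kA|kA] := ltnP k (size A); last first.
  by rewrite nth_default// nc0 mulr_ge0// sumr_ge0// => i _; rewrite mulr_ge0 ?nc_ge0.
rewrite (bigD1 (Ordinal kA))//= mulrDl -mulrA -exprMn mulfV// expr1n mulr1 lerDl.
by rewrite mulr_ge0// sumr_ge0// => i _; rewrite mulr_ge0 ?nc_ge0.
Qed.

(** The rank [d/2] of K_u equals that of H_u exactly for even [d]; this is how the parity of [d] is
    read off [u]. *)
Lemma Vd_hankel1 d u : inVd d u -> (hankel (uphalf d) u 1 \in unitmx) = ~~ odd d.
Proof.
move=> [A [B h]]; have [sA sB _] := Vd_size h.
have B0 : B`_0 = 1 by case: h.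
rewrite (hankel1_unit (Vd_hankel h) sB B0); last by move=> k; exact: Vd_recurrence h.
case: h => _ _ _; rewrite uphalf_half in sA sB *; case: (odd d) sA sB => /= sA sB.
  by move=> [_ h] _; rewrite nth_default ?eqxx// add1n.
move=> [_ h] _; rewrite add0n; have -> : d./2 = (size B).-1 by rewrite h.
rewrite -lead_coefE lead_coef_eq0 orbC; case: eqP => //= _.
by rewrite -size_poly_eq0 h.
Qed.

(** Invertibility of the Hankel matrix supplies coprimality and, for odd [d], the exact degree of
    [A]; the top coefficient of [B] carries the parity. *)
Lemma Vd_of_hankel d A B u : (forall k, pconv B u k = A`_k) -> B`_0 = 1 ->
  (forall z, nc z <= 1 -> B.[z] != 0) ->
  (size A <= uphalf d)%N -> (size B <= (uphalf d).+1)%N ->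
  hankel (uphalf d) u 0 \in unitmx -> (B`_(uphalf d) == 0) = odd d ->
  Vd_repr d A B u.
Proof.
move=> hu B0 hB sA sB Hu Bd; split=> //; first exact: coprimep_hankel Hu hu B0 sA sB.
case: (boolP (odd d)) Bd => od.
- have dE : uphalf d = d./2.+1 by rewrite uphalf_half od.
  rewrite dE in sA sB Hu *; move=> /eqP Bd.
  have sB' : (size B <= d./2.+1)%N.
    by apply/leq_sizeP => j; rewrite leq_eqVlt => /orP[/eqP<-//|]; move/leq_sizeP: sB; apply.
  by split=> //; exact: size_hankel Hu hu B0 sA sB'.
- have dE : uphalf d = d./2 by rewrite uphalf_half (negbTE od).
  rewrite dE in sA sB Hu *; move=> /eqP Bd; split=> //.
  apply/eqP; rewrite eqn_leq sB ltnNge; apply/negP => sB'; apply: Bd.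
  by rewrite nth_default.
Qed.

End Vd.

(** * Balanced realizations *)

Section Adjoint.
Variable C : numClosedFieldType.

Lemma adjmxM m n p (A : 'M[C]_(m, n)) (B : 'M[C]_(n, p)) :
  (A *m B)^t* = B^t* *m A^t*.
Proof. by rewrite trmx_mul map_mxM. Qed.

Lemma adjmx1 n : (1%:M : 'M[C]_n)^t* = 1%:M.
Proof. by rewrite trmx1 map_mx1. Qed.

Lemma adjmx0 m n : (0 : 'M[C]_(m, n))^t* = 0.
Proof. by rewrite trmx0 map_mx0. Qed.

Lemma adjmxB m n (A B : 'M[C]_(m, n)) : (A - B)^t* = A^t* - B^t*.
Proof. by rewrite linearB /= map_mxB. Qed.

Lemma adjmxZ m n a (A : 'M[C]_(m, n)) : (a *: A)^t* = a^* *: A^t*.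
Proof. by rewrite linearZ /= map_mxZ. Qed.

Lemma adjmxX n (A : 'M[C]_n.+1) k : (A ^+ k)^t* = (A^t*) ^+ k.
Proof.
elim: k => [|k IH]; first by rewrite !expr0 adjmx1.
by rewrite exprS adjmxM IH mulmxE -exprSr.
Qed.

Lemma adjmx_diag n (d : 'rV[C]_n) : (diag_mx d)^t* = diag_mx (map_mx Num.Def.conjC d).
Proof. by rewrite tr_diag_mx map_diag_mx. Qed.

Lemma mxdot_ge0 n (x : 'rV[C]_n) : 0 <= (x *m x^t*) 0 0.
Proof. by rewrite mxE sumr_ge0// => i _; rewrite !mxE mul_conjC_ge0. Qed.

Lemma mxdot_eq0 n (x : 'rV[C]_n) : (x *m x^t*) 0 0 = 0 -> x = 0.
Proof.
rewrite mxE => /eqP; rewrite psumr_eq0 => [/allP h|i _]; last by rewrite !mxE mul_conjC_ge0.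
apply/rowP => i; rewrite !mxE; apply/eqP.
by have := h i (mem_index_enum _); rewrite !mxE mul_conjC_eq0.
Qed.

Lemma mx11_eq0 (A : 'M[C]_1) : A 0 0 = 0 -> A = 0.
Proof. by move=> h; rewrite [A]mx11_scalar h raddf0. Qed.

Lemma mxdot_eq0_mx n (x : 'rV[C]_n) : x *m x^t* = 0 -> x = 0.
Proof. by move=> e; apply: mxdot_eq0; rewrite e mxE. Qed.

Lemma eq_subr_self (V : zmodType) (a b : V) : a = a - b -> b = 0.
Proof. by move=> /(congr1 (fun z => a - z)); rewrite subrr subKr. Qed.

Definition posdefmx n (P : 'M[C]_n) :=
  P^t* = P /\ forall x : 'rV_n, x != 0 -> 0 < (x *m P *m x^t*) 0 0.

Lemma hermitian_spectral n (P : 'M[C]_n) : P^t* = P ->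
  exists S (D : 'rV[C]_n), S \is unitarymx /\ P = S^t* *m diag_mx D *m S.
Proof.
move=> hP; have /orthomx_spectralP PE : P \is normalmx by apply/normalmxP; rewrite hP.
exists (spectralmx P), (spectral_diag P); split; first exact: spectral_unitarymx.
by rewrite {1}PE invmx_unitary// spectral_unitarymx.
Qed.

Lemma unitarymx_adjK n (S : 'M[C]_n) : S \is unitarymx -> S^t* *m S = 1%:M.
Proof. by move=> /unitarymxP/mulmx1C. Qed.

Lemma posdef_factor n (P : 'M[C]_n) : posdefmx P ->
  exists2 L : 'M[C]_n, L \in unitmx & P = L *m L^t*.
Proof.
move=> [hP pP]; have [S [D [Su PE]]] := hermitian_spectral hP.
(* The quadratic form of [P] at the [i]-th row of [S] equals [D 0 i]. *)
have D0 i : 0 < D 0 i.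
  have xn0 : row i S != 0.
    apply/eqP => r0; have /unitarymxP/(congr1 (row i)) := Su.
    rewrite row_mul r0 mul0mx => /rowP/(_ i); rewrite !mxE eqxx => /eqP.
    by rewrite eq_sym oner_eq0.
  have := pP _ xn0; rewrite PE.
  have -> : (row i S)^t* = S^t* *m (delta_mx 0 i)^T.
    by rewrite rowE adjmxM; congr (_ *m _); apply/matrixP => k l; rewrite !mxE rmorph_nat.
  rewrite rowE !mulmxA -(mulmxA _ S) (unitarymxP Su) mulmx1 -(mulmxA _ S) (unitarymxP Su) mulmx1.
  by rewrite -rowE row_diag_mx -scalemxAl trmx_delta mul_delta_mx !mxE !eqxx mulr1.
exists (S^t* *m diag_mx (\row_i sqrtC (D 0 i))).
  rewrite unitmx_mul unitarymx_unit ?trmxC_unitary//= unitmxE det_diag unitfE.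
  by apply/prodf_neq0 => i _; rewrite mxE sqrtC_eq0 gt_eqF.
rewrite adjmxM trmxCK adjmx_diag PE mulmxA -[X in _ = X *m _]mulmxA mulmx_diag.
congr (_ *m diag_mx _ *m _); apply/rowP => i; rewrite !mxE.
rewrite conj_Creal; first by rewrite -expr2 sqrtCK.
by rewrite ger0_real// sqrtC_ge0 ltW.
Qed.

Lemma stable_eigenvector n (A W : 'M[C]_n) : W != 0 -> stablemx W A ->
  exists (x : 'rV[C]_n) a, [/\ x != 0, (x <= W)%MS & x *m A = a *: x].
Proof.
move=> W0 WA; have r0 : (0 < \rank W)%N by rewrite lt0n mxrank_eq0.
have [a /eigenvalueP[v vE v0]] := eigenvalue_closed (restrictmx W A) r0.
exists (v *m row_base W), a; split.
- by rewrite mulmx_free_eq0 ?row_base_free.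
- by rewrite mulmx_sub// eq_row_base.
- have WA' : stablemx (row_base W) A by rewrite stablemx_row_base.
  have := congr1 (mulmx^~ (row_base W)) vE.
  by rewrite /= /conjmx -scalemxAl -mulmxA (mulmxKpV WA') mulmxA.
Qed.

Lemma char_poly_trmx n (A : 'M[C]_n) : char_poly A^T = char_poly A.
Proof.
rewrite /char_poly -det_tr; congr (\det _).
by apply/matrixP => i j; rewrite !mxE eq_sym.
Qed.

Lemma Cayley_Hamilton_powers n (A : 'M[C]_n.+1) k :
  \sum_(j < n.+2) (char_poly A)`_j *: A ^+ (j + k) = 0.
Proof.
have := Cayley_Hamilton A; move/(congr1 (fun X => X *m A ^+ k)); rewrite mul0mx => {2}<-.
rewrite -{2}[char_poly A]coefK size_char_poly poly_def rmorph_sum /= mulmx_suml.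
apply: eq_bigr => j _; rewrite exprD.
by rewrite -mul_polyC rmorphM /= rmorphXn /= horner_mx_C horner_mx_X -mulmxE mul_scalar_mx -scalemxAl.
Qed.

(** Cayley-Hamilton. It makes the subspace cut out by the first [n.+1] conditions stable under
    [A]. *)
Lemma powers_vanish n p (A : 'M[C]_n.+1) (x : 'rV[C]_n.+1) (w : 'M[C]_(n.+1, p)) :
  (forall k, (k < n.+1)%N -> x *m A ^+ k *m w = 0) -> forall k, x *m A ^+ k *m w = 0.
Proof.
move=> h; elim/ltn_ind => k IH; have [|kn] := ltnP k n.+1; first exact: h.
have := Cayley_Hamilton_powers A (k - n.+1).
rewrite big_ord_recr /= subnKC// => /(congr1 (fun X => x *m X *m w)).
rewrite mulmx0 mul0mx mulmxDr mulmxDl mulmx_sumr mulmx_suml big1 ?add0r => [|j _].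
  have /monicP : char_poly A \is monic := char_poly_monic A.
  by rewrite lead_coefE size_char_poly /= => ->; rewrite scale1r.
rewrite -scalemxAr -scalemxAl IH ?scaler0//.
have := ltn_ord j; lia.
Qed.

End Adjoint.

Section Balanced.
Variables (C : numClosedFieldType) (n : nat).
Implicit Types (T P U V : 'M[C]_n.+1) (b c x : 'rV[C]_n.+1).

(* The realization [u_k = b T^k c^*] in which the observability Gramian is the identity and the
   controllability Gramian [P] represents [H_u^2]; then [P - b^* b] represents [K_u^2]. *)
Definition balanced T P b c :=
  [/\ T *m T^t* = 1%:M - c^t* *m c, T^t* *m P *m T = P - b^t* *m b & posdefmx P].

(** As [T T^* = 1 - c^* c] makes [T] a contraction, these are the only eigenvalues that could
    destroy stability. *)
Definition no_unimodular_eigenvalue T :=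
  forall x a, `|a| = 1 -> x *m T = a *: x -> x = 0.

(** The last clause says more than commutation: [U] is a scalar on each eigenspace of [P], which is
    what a function of [P] means. *)
Definition unitary_function P U :=
  [/\ U *m U^t* = 1%:M, P *m U = U *m P &
      forall x s, x *m P = s *: x -> exists2 a : C, `|a| = 1 & x *m U = a *: x].

Lemma unimodular_conj (a : C) : `|a| = 1 -> a * a^* = 1.
Proof. by move=> h; rewrite -normCK h expr1n. Qed.

Lemma unimodular_neq0 (a : C) : `|a| = 1 -> a != 0.
Proof. by move=> h; rewrite -normr_eq0 h oner_eq0. Qed.

Section Rotation.
Variables (T P U V : 'M[C]_n.+1) (b c : 'rV[C]_n.+1).
Hypothesis bal : balanced T P b c.
Hypothesis fU : unitary_function P U.
Hypothesis fV : unitary_function (P - b^t* *m b) V.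

Let UU : U^t* *m U = 1%:M. Proof. by case: fU => /mulmx1C. Qed.
Let VV : V^t* *m V = 1%:M. Proof. by case: fV => /mulmx1C. Qed.

(** [V] and [U] cancel in [T T^*]; in the second identity [V] commutes with [T^* P T = P - b^* b]
    and [U] with [P]. *)
Lemma balanced_rotation : balanced (T *m V *m U) P (b *m U) c.
Proof.
case: bal fU fV => h1 h2 h3 [U1 PU _] [V1 QV _]; split=> //.
- by rewrite !adjmxM !mulmxA -(mulmxA (T *m V)) U1 mulmx1 -(mulmxA T) V1 mulmx1.
- rewrite !adjmxM !mulmxA.
  have -> : U^t* *m V^t* *m T^t* *m P *m T *m V *m U =
     U^t* *m V^t* *m (T^t* *m P *m T) *m V *m U by rewrite !mulmxA.
  rewrite h2 -(mulmxA _ _ V) QV !mulmxA -(mulmxA _ (V^t*)) VV mulmx1.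
  rewrite mulmxBr mulmxBl -(mulmxA _ P) PU !mulmxA UU mul1mx; congr (_ - _).
Qed.

(* Eigenvectors [x] of [T V U] for a unimodular eigenvalue satisfy [x c^* = 0] and [x (b U)^* = 0],
   which makes their space stable under [P]; there [U], [V] act by scalars on an eigenvector of [P],
   which is therefore an eigenvector of [T]. *)
Lemma rotation_no_unimodular :
  no_unimodular_eigenvalue T -> no_unimodular_eigenvalue (T *m V *m U).
Proof.
move=> nT; have [h1 h2 h3] := balanced_rotation.
have [T' T'E] : exists T', T' = T *m V *m U by eexists.
have [b' b'E] : exists b', b' = b *m U by eexists.
rewrite -T'E -?b'E in h1 h2 *.
move=> x0 a a1 x0E; apply/eqP; apply: contraT => x00.
have a0 := unimodular_neq0 a1; have aa := unimodular_conj a1.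
have adjE x : x *m T' = a *: x -> [/\ x *m c^t* = 0, x *m T'^t* = a^* *: x & T' *m x^t* = a *: x^t*].
  move=> xE.
  (* The unimodular factor [a] keeps the norm of [x], so the defect [c^* c] of the contraction
     vanishes on [x]. *)
  have xc : x *m c^t* = 0.
    have /(congr1 (fun X => x *m X *m x^t*)) := h1.
    have -> : x *m (T' *m T'^t*) *m x^t* = x *m x^t*.
      rewrite mulmxA xE -scalemxAl -scalemxAl -mulmxA -adjmxM xE adjmxZ -scalemxAr scalerA.
      by rewrite aa scale1r.
    rewrite mulmxBr mulmxBl mulmx1 => /eq_subr_self e.
    apply: mxdot_eq0_mx; by rewrite adjmxM trmxCK -e !mulmxA.
  have xT : x *m T'^t* = a^* *: x.
    have /(congr1 (mulmx x)) := h1; rewrite mulmxBr mulmx1 !mulmxA xc mul0mx subr0 xE.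
    by rewrite -scalemxAl => {2}<-; rewrite scalerA mulrC aa scale1r.
  split=> //; have /(congr1 (fun X => X^t*)) := xT.
  by rewrite adjmxM trmxCK adjmxZ conjCK.
have PE x : x *m T' = a *: x -> x *m b'^t* = 0 /\ x *m P *m T' = a *: (x *m P).
  move=> xE; have [xc xT Tx] := adjE x xE.
  have e : x *m P *m T' = a *: (x *m P) - a *: (x *m b'^t* *m b').
    have /(congr1 (mulmx x)) := h2; rewrite !mulmxA xT -!scalemxAl mulmxBr mulmxA.
    by move=> /(congr1 (fun X => a *: X)); rewrite scalerA aa scale1r scalerBr.
  (* Paired with [x^*], an eigenvector of [T'] from the other side, the terms in [P] cancel and
     leave the square of [x b'^*]. *)
  suff xb : x *m b'^t* = 0 by split=> //; rewrite e xb mul0mx scaler0 subr0.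
  have /(congr1 (fun X => X *m x^t*)) := e.
  rewrite -mulmxA Tx -scalemxAr mulmxBl -!scalemxAl => /eq_subr_self /eqP.
  rewrite scaler_eq0 (negbTE a0) /= => /eqP e'.
  by apply: mxdot_eq0_mx; rewrite adjmxM trmxCK -e' !mulmxA.
have [||x [s [xn0 xW xP]]] := @stable_eigenvector _ _ P (eigenspace T' a).
- apply/eqP => W0; have : (x0 <= eigenspace T' a)%MS by apply/eigenspaceP.
  by rewrite W0 submx0 (negbTE x00).
- apply/row_subP => i; apply/eigenspaceP.
  have /eigenspaceP xE := row_sub i (eigenspace T' a).
  by rewrite row_mul; have [] := PE _ xE.
move/eigenspaceP: xW => xE.
have [xb' _] := PE _ xE; have [xc _ _] := adjE _ xE.
have [U1 PU /(_ x s xP)[mu mu1 xU]] := fU.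
have xU' : x *m U^t* = mu^* *: x.
  have : x *m U *m U^t* = x by rewrite -mulmxA U1 mulmx1.
  rewrite xU -scalemxAl => {2}<-; rewrite scalerA mulrC unimodular_conj//.
  by rewrite scale1r.
have xb : x *m b^t* = 0.
  have := xb'; rewrite b'E adjmxM mulmxA xU' -scalemxAl => /eqP.
  by rewrite scaler_eq0 conjC_eq0 (negbTE (unimodular_neq0 mu1)) => /eqP.
have [g1 g2 g3] := bal.
(* [T T^*] fixes [x] since [x c^* = 0], and [T^* P T = P - b^* b]: so [x T] satisfies the
   eigenvector equation of [P - b^* b], and [V] acts on it by a scalar. *)
have xTQ : x *m T *m (P - b^t* *m b) = s *: (x *m T).
  rewrite -g2 !mulmxA -(mulmxA x T) g1 mulmxBr mulmx1 mulmxA xc mul0mx subr0.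
  by rewrite xP -scalemxAl.
have [V1 QV /(_ _ _ xTQ)[nu nu1 xV]] := fV.
have xT : x *m T = (nu^-1 * a * mu^*) *: x.
  have /(congr1 (fun X => X *m U^t*)) := xE.
  rewrite T'E !mulmxA -(mulmxA _ U) U1 mulmx1 xV -scalemxAl xU' scalerA => h.
  have := congr1 (fun X => nu^-1 *: X) h.
  by rewrite scalerA mulVf ?unimodular_neq0// scale1r scalerA mulrA.
move/eqP: xn0; case; apply: nT xT.
by rewrite !normrM normfV norm_conjC a1 mu1 nu1 invr1 !mulr1.
Qed.

End Rotation.

(** The unobservable subspace is stable under [T]. An eigenvector in it is orthogonal to [c], so by
    the first identity [T] keeps its norm and the eigenvalue is unimodular. *)
Lemma balanced_observable T P b c : balanced T P b c -> no_unimodular_eigenvalue T ->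
  forall x, (forall k, (k < n.+1)%N -> x *m T ^+ k *m c^t* = 0) -> x = 0.
Proof.
move=> [h1 _ _] nT x xh; apply/eqP; apply: contraT => xn0.
pose O : 'M[C]_n.+1 := \matrix_(i, j) (T ^+ j *m c^t*) i 0.
have OE (y : 'rV[C]_n.+1) : y *m O = 0 <-> forall k, (k < n.+1)%N -> y *m T ^+ k *m c^t* = 0.
  have colE k (kn : (k < n.+1)%N) : (y *m O) 0 (Ordinal kn) = (y *m T ^+ k *m c^t*) 0 0.
    by rewrite -mulmxA !mxE; apply: eq_bigr => i _; rewrite mxE.
  split=> [h k kn|h]; last first.
    by apply/rowP => -[k kn]; rewrite colE h// !mxE.
  by apply: mx11_eq0; rewrite -(colE k kn) h mxE.
have [||y [a [yn0 yW yT]]] := @stable_eigenvector _ _ T (kermx O).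
- apply/eqP => W0; have : (x <= kermx O)%MS by apply/sub_kermxP/OE.
  by rewrite W0 submx0 (negbTE xn0).
- apply/row_subP => i; apply/sub_kermxP; rewrite row_mul; apply/OE => k _.
  have /sub_kermxP/OE/powers_vanish h := row_sub i (kermx O).
  by have := h k.+1; rewrite exprS -mulmxE !mulmxA.
move/sub_kermxP/OE: yW => /(_ 0 isT); rewrite expr0 mulmx1 => yc.
suff a1 : `|a| = 1 by move/eqP: yn0; case; apply: nT a1 yT.
have /(congr1 (fun X => (y *m X *m y^t*) 0 0)) := h1.
rewrite mulmxBr mulmx1 !mulmxA yc mul0mx subr0 yT -!scalemxAl -mulmxA -adjmxM yT adjmxZ -scalemxAr scalerA mxE -normCK.
have yy : (y *m y^t*) 0 0 != 0 by apply/eqP => /mxdot_eq0 y0; move/eqP: yn0; apply.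
move=> /eqP; rewrite -{2}[_ 0 0]mul1r (inj_eq (mulIf yy)) sqrp_eq1 ?normr_ge0//.
by move=> /eqP.
Qed.

(** The dual argument, with [T^*] and the norm defined by [P]: for an eigenvector orthogonal to [b]
    the second identity forces a unimodular eigenvalue. *)
Lemma balanced_controllable T P b c : balanced T P b c -> no_unimodular_eigenvalue T ->
  forall x, (forall k, (k < n.+1)%N -> x *m (T ^+ k)^t* *m b^t* = 0) -> x = 0.
Proof.
move=> [h1 h2 [Ph Pp]] nT x xh; apply/eqP; apply: contraT => xn0.
pose O : 'M[C]_n.+1 := \matrix_(i, j) ((T ^+ j)^t* *m b^t*) i 0.
have OE (y : 'rV[C]_n.+1) : y *m O = 0 <-> forall k, (k < n.+1)%N -> y *m (T^t*) ^+ k *m b^t* = 0.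
  have colE k (kn : (k < n.+1)%N) : (y *m O) 0 (Ordinal kn) = (y *m (T^t*) ^+ k *m b^t*) 0 0.
    by rewrite -mulmxA !mxE; apply: eq_bigr => i _; rewrite mxE adjmxX.
  split=> [h k kn|h]; last first.
    by apply/rowP => -[k kn]; rewrite colE h// !mxE.
  by apply: mx11_eq0; rewrite -(colE k kn) h mxE.
have [||y [a [yn0 yW yT]]] := @stable_eigenvector _ _ (T^t*) (kermx O).
- apply/eqP => W0; have : (x <= kermx O)%MS.
    by apply/sub_kermxP/OE => k kn; rewrite -adjmxX xh.
  by rewrite W0 submx0 (negbTE xn0).
- apply/row_subP => i; apply/sub_kermxP; rewrite row_mul; apply/OE => k _.
  have /sub_kermxP/OE/powers_vanish h := row_sub i (kermx O).
  by have := h k.+1; rewrite exprS -mulmxE !mulmxA.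
move/sub_kermxP/OE: yW => /(_ 0 isT); rewrite expr0 mulmx1 => yb.
have yy : (y *m P *m y^t*) 0 0 != 0 by rewrite gt_eqF// Pp.
have a1 : `|a| = 1.
  have /(congr1 (fun X => (y *m X *m y^t*) 0 0)) := h2.
  rewrite mulmxBr !mulmxA yb mul0mx mulmxBl mul0mx subr0 yT -!scalemxAl.
  have Ty : T *m y^t* = a^* *: y^t* by rewrite -adjmxZ -yT adjmxM trmxCK.
  rewrite -mulmxA Ty -scalemxAr scalerA mxE -normCK => /eqP.
  rewrite -{2}[_ 0 0]mul1r (inj_eq (mulIf yy)) sqrp_eq1 ?normr_ge0//.
  by move=> /eqP.
(* A unimodular eigenvalue of [T^*] is one of [T], up to conjugation. *)
have yc : eigenvalue T (a^*).
  rewrite eigenvalue_root_char; suff : eigenvalue (T^T) (a^*).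
    by rewrite eigenvalue_root_char char_poly_trmx.
  apply/eigenvalueP; exists (map_mx Num.Def.conjC y); last by rewrite map_mx_eq0.
  have /(congr1 (fun X => map_mx Num.Def.conjC X)) := yT; rewrite map_mxM map_mxZ /= map_mxCK//.
have [z zE zn0] := eigenvalueP yc.
by move/eqP: zn0; case; apply: nT zE; rewrite norm_conjC.
Qed.

End Balanced.

(** * Stein equations and existence of balanced realizations *)

Section Stein.
Variables (R : realType) (n : nat).
Local Notation C := R[i].
Implicit Types (A X : 'M[C]_n.+1) (x e : 'rV[C]_n.+1).

Definition stablemx_pow A := geodecay (fun k => mxnc (A ^+ k)).

Lemma stable_no_unimodular A : stablemx_pow A -> no_unimodular_eigenvalue A.
Proof.
move=> sA x a a1 xA; apply/mxnc_eq0/(geodecay_le0 (geodecayZ (mxnc_ge0 x) sA)) => k.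
have xAk : x *m A ^+ k = a ^+ k *: x.
  elim: k => [|k IH]; first by rewrite !expr0 mulmx1 scale1r.
  by rewrite exprSr -mulmxE mulmxA IH -scalemxAl xA scalerA -exprSr.
apply: le_trans (mxncM x (A ^+ k)); rewrite xAk.
apply: ler_sum => i _; apply: ler_sum => j _.
have na : nc a = 1 by apply: complexI; rewrite -nc_norm a1.
by rewrite mxE ncM ncX na expr1n mul1r.
Qed.

Lemma stable_adj A : stablemx_pow A -> stablemx_pow (A^t*).
Proof. by apply: geodecay_le => k; rewrite -adjmxX mxnc_adj. Qed.

Definition stein A X := X - A *m X *m A^t*.

Fact stein_is_linear A : linear (stein A).
Proof.
move=> a X Y; rewrite /stein mulmxDr mulmxDl -scalemxAr -scalemxAl scalerBr.
by rewrite opprD addrACA.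
Qed.
HB.instance Definition _ A := GRing.isLinear.Build C _ _ _ (stein A) (stein_is_linear A).

Lemma stein_iter A X k : stein A X = 0 -> X = A ^+ k *m X *m (A ^+ k)^t*.
Proof.
move=> /eqP; rewrite subr_eq0 => /eqP XE; elim: k => [|k IH].
  by rewrite expr0 adjmx1 mul1mx mulmx1.
by rewrite {1}IH {1}XE exprSr -mulmxE adjmxM !mulmxA.
Qed.

Lemma stein_inj A X : stablemx_pow A -> stein A X = 0 -> X = 0.
Proof.
move=> sA XE; apply/mxnc_eq0.
have g : geodecay (fun k => mxnc X * (mxnc (A ^+ k) * mxnc (A ^+ k))).
  apply: (geodecayZ (mxnc_ge0 X)); apply: geodecayM => // k; exact: mxnc_ge0.
apply: (geodecay_le0 g) => k; rewrite {1}(stein_iter k XE).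
rewrite (le_trans (mxncM _ _))// mxnc_adj (le_trans (ler_wpM2r (mxnc_ge0 _) (mxncM _ _)))//.
by rewrite mulrCA mulrA.
Qed.

(** An injective endomorphism of the finite-dimensional space of matrices is onto, so no matrix
    series has to be summed. *)
Lemma stein_solve A Q : stablemx_pow A -> exists X, stein A X = Q.
Proof.
move=> sA; have Mu : lin_mx (stein A) \in unitmx.
  apply: unitmx_inj => v; rewrite mul_rV_lin => /eqP; rewrite mxvec_eq0 => /eqP.
  by move=> /(stein_inj sA) h; rewrite -[v]vec_mxK h linear0.
exists (vec_mx (mxvec Q *m invmx (lin_mx (stein A)))).
by rewrite -mx_rV_lin mulmxKV// mxvecK.
Qed.

(* The solution is [X = sum_k A^k e^t* e A^t*^k]. *)
Lemma stein_posdef A e : stablemx_pow A ->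
  (forall x, (forall k, x *m A ^+ k *m e^t* = 0) -> x = 0) ->
  exists2 X, posdefmx X & A *m X *m A^t* = X - e^t* *m e.
Proof.
move=> sA obs; have [X XE] := stein_solve (e^t* *m e) sA.
have Xh : X^t* = X.
  apply/eqP; rewrite -subr_eq0; apply/eqP/(stein_inj sA).
  rewrite linearB /= XE; apply/eqP; rewrite subr_eq0; apply/eqP.
  have := congr1 (fun Y => Y^t*) XE.
  by rewrite /stein adjmxB !adjmxM !trmxCK mulmxA.
exists X; last by rewrite -XE /stein subKr.
split=> // x xn0.
pose s N := \sum_(k < N) nc ((x *m A ^+ k *m e^t*) 0 0) ^+ 2.
pose rem N := (x *m A ^+ N *m X *m (x *m A ^+ N)^t*) 0 0.
(* Iterating the equation [N] times extracts [N] squares from the quadratic form and leaves a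
   remainder that tends to zero. *)
have zE N : (x *m X *m x^t*) 0 0 = (s N)%:C%C + rem N.
  elim: N => [|N IH].
    by rewrite /s big_ord0 add0r /rem expr0 mulmx1.
  rewrite IH /s big_ord_recr /= rmorphD /= -addrA; congr (_ + _).
  rewrite rmorphXn /= -nc_norm normCK.
  have XE' : X = e^t* *m e + A *m X *m A^t* by rewrite -XE /stein subrK.
  rewrite /rem {1}XE' mulmxDr mulmxDl mxE; congr (_ + _).
    set y := x *m A ^+ N; have -> : y *m (e^t* *m e) *m y^t* = (y *m e^t*) *m (y *m e^t*)^t*.
      by rewrite adjmxM trmxCK !mulmxA.
    by rewrite mxE big_ord1 !mxE.
  by rewrite exprSr -mulmxE !adjmxM !mulmxA.
have remg : geodecay (fun N => nc (rem N)).
  have g : geodecay (fun N => mxnc X * mxnc x ^+ 2 * (mxnc (A ^+ N) * mxnc (A ^+ N))).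
    apply: geodecayZ; first by rewrite mulr_ge0 ?exprn_ge0 ?mxnc_ge0.
    apply: geodecayM => // k; exact: mxnc_ge0.
  apply: geodecay_le g => N; rewrite (le_trans (mxnc_entry _ _ _))//.
  rewrite (le_trans (mxncM _ _))// mxnc_adj.
  have h : mxnc (x *m A ^+ N) <= mxnc x * mxnc (A ^+ N) by exact: mxncM.
  have h' : mxnc (x *m A ^+ N *m X) <= mxnc x * mxnc (A ^+ N) * mxnc X.
    by rewrite (le_trans (mxncM _ _))// ler_wpM2r ?mxnc_ge0.
  rewrite (le_trans (ler_pM _ _ h' h)) ?mxnc_ge0//.
  by rewrite le_eqVlt; apply/orP; left; apply/eqP; ring.
set z := _ 0 0 in zE *.
have zr : z = (complex.Re z)%:C%C.
  suff : z^* = z by move=> /CrealP/RRe_real.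
  have -> : z^* = ((x *m X *m x^t*)^t*) 0 0 by rewrite [in RHS]mxE [in RHS]mxE.
  by rewrite !adjmxM trmxCK Xh mulmxA.
rewrite zr ltcR.
have smono N k : s N <= s (N + k)%N.
  elim: k => [|k IH]; first by rewrite addn0.
  by rewrite addnS (le_trans IH)// /s [leRHS]big_ord_recr /= lerDl exprn_ge0// nc_ge0.
have sz N : s N <= complex.Re z.
  rewrite -subr_le0; apply: (geodecay_le0 (geodecay_shift N remg)) => k.
  apply: le_trans (nc_Re _); rewrite -normrN; apply: le_trans (ler_norm _).
  have /(congr1 (fun w => complex.Re w)) := zE (k + N)%N.
  rewrite -[complex.Re (_ + _)]/(complex.Re ((s (k + N)%N)%:C%C + rem (k + N)%N : R[i])).
  case: (rem _) => p q /= ->; rewrite opprD addrA gerDr subr_le0 addnC; exact: smono.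
case: (pselect (exists k, x *m A ^+ k *m e^t* <> 0)) => [[k xk]|h]; last first.
  move/eqP: xn0; case; apply: obs => k.
  by apply: contrapT => xk; apply: h; exists k.
apply: lt_le_trans (sz k.+1); rewrite /s big_ord_recr /=.
apply: ltr_wpDl; first by apply: sumr_ge0 => i _; rewrite exprn_ge0// nc_ge0.
rewrite exprn_gt0// lt_def nc_ge0 andbT nc_eq0; apply/eqP => h; apply: xk.
exact: mx11_eq0.
Qed.

End Stein.

Section BalancedRealization.
Variables (R : realType) (n : nat).
Local Notation C := R[i].
Implicit Types (u : nat -> C) (B : {poly C}).

Lemma geodecay_hankel u : geodecay (fun k => nc (u k)) ->
  geodecay (fun k => mxnc (hankel n.+1 u k)).
Proof.
move=> gu; apply: geodecay_sum => i _; apply: geodecay_sum => j _.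
by apply: geodecay_le (geodecay_shift (i + j) gu) => k; rewrite mxE addnC.
Qed.

(** The product shifts the rows of the Hankel matrices: the first [n.+1] rows by the choice of the
    matrix, the later ones by the recurrence, in which the constant coefficient 1 of [B] isolates
    the newest term. *)
Lemma hankel_shift u B : hankel n.+1 u 0 \in unitmx -> (size B <= n.+2)%N -> B`_0 = 1 ->
  (forall k, (n.+1 <= k)%N -> pconv B u k = 0) ->
  forall k, hankel n.+1 u k *m (invmx (hankel n.+1 u 0) *m hankel n.+1 u 1) = hankel n.+1 u k.+1.
Proof.
move=> Hu sB B0 hB.
set G := hankel n.+1 u 0; set A := invmx G *m _.
pose Y k : 'rV[C]_n.+1 := \row_j u (k + j)%N.
have rowY k (i : 'I_n.+1) : row i (hankel n.+1 u k) = Y (i + k)%N.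
  by apply/rowP => j; rewrite !mxE addnAC.
suff YA : forall k, Y k *m A = Y k.+1.
  by move=> k; apply/row_matrixP => i; rewrite row_mul !rowY YA addnS.
have Yrec k : (n.+1 <= k)%N -> Y k = - \sum_(j < n.+1) B`_j.+1 *: Y (k - j.+1)%N.
  move=> nk; apply/rowP => i; have := hB (k + i)%N (leq_trans nk (leq_addr _ _)).
  rewrite (pconv_size _ sB); last by rewrite (leq_trans nk)// leq_addr.
  rewrite big_ord_recl subn0 B0 mul1r => /eqP; rewrite addr_eq0 => /eqP.
  rewrite !mxE summxE => ->; congr (- _); apply: eq_bigr => j _; rewrite !mxE /= /bump /= add1n.
  by congr (_ * u _); have := ltn_ord j; lia.
elim/ltn_ind => k IH; have [kn|nk] := ltnP k n.+1.
  have := congr1 (row (Ordinal kn)) (mulKVmx Hu (hankel n.+1 u 1)).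
  by rewrite row_mul !rowY /= addn0 addn1.
rewrite (Yrec k)// (Yrec k.+1) ?leqW// mulNmx mulmx_suml; congr (- _).
apply: eq_bigr => j _; rewrite -scalemxAl IH; last by have := ltn_ord j; lia.
by congr (_ *: Y _); have := ltn_ord j; lia.
Qed.

(** The matrix [A] that shifts Hankel rows realizes [u] with input [row 0 G] and output [e^*]. Its
    observability Gramian [L L^*] becomes 1 after conjugation by [L], and [P] is the controllability
    Gramian in the new basis. *)
Lemma balanced_realization u B : hankel n.+1 u 0 \in unitmx -> (size B <= n.+2)%N -> B`_0 = 1 ->
  (forall k, (n.+1 <= k)%N -> pconv B u k = 0) -> geodecay (fun k => nc (u k)) ->
  exists (T P : 'M[C]_n.+1) (b c : 'rV[C]_n.+1), [/\ balanced T P b c, stablemx_pow T,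
    (T \in unitmx) = (hankel n.+1 u 1 \in unitmx) &
    forall k, u k = (b *m T ^+ k *m c^t*) 0 0].
Proof.
move=> Hu sB B0 hB gu; have HA := hankel_shift Hu sB B0 hB.
have [G GE] : exists G, G = hankel n.+1 u 0 by eexists.
have [A AE] : exists A, A = invmx G *m hankel n.+1 u 1 by eexists.
rewrite -GE -AE in Hu HA.
have GA k : G *m A ^+ k = hankel n.+1 u k.
  elim: k => [|k IH]; first by rewrite expr0 mulmx1 GE.
  by rewrite exprSr -mulmxE mulmxA IH HA.
have [e eE] : exists e : 'rV[C]_n.+1, e^t* = delta_mx 0 0.
  by exists (delta_mx 0 0); apply/matrixP => i j; rewrite !mxE rmorph_nat andbC.
have sA : stablemx_pow A.
  apply: geodecay_le (geodecayZ (mxnc_ge0 (invmx G)) (geodecay_hankel gu)) => k.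
  by rewrite -GA; apply: le_trans (mxncM _ _); rewrite mulKmx.
have he k (y : 'rV_n.+1) : (y *m G *m A ^+ k *m e^t*) 0 0 = \sum_i y 0 i * u (i + k)%N.
  rewrite -(mulmxA y) GA eE -colE !mxE; apply: eq_bigr => i _.
  by rewrite !mxE addn0.
have obs (x : 'rV_n.+1) : (forall k, x *m A ^+ k *m e^t* = 0) -> x = 0.
  move=> h; rewrite -(mulmxKV Hu x); set y := x *m invmx G.
  suff -> : y *m G = 0 by [].
  apply/rowP => j; transitivity (\sum_i y 0 i * u (i + j)%N).
    by rewrite GE mxE; apply: eq_bigr => i _; rewrite [hankel _ _ _ i j]mxE addn0.
  by rewrite -he /y mulmxKV// h !mxE.
have [X /posdef_factor[L Lu ->] AX] := stein_posdef sA obs.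
have [T TE] : exists T, T = invmx L *m A *m L by eexists.
have [c cE'] : exists c, c = e *m (invmx L)^t* by eexists.
have [b bE] : exists b, b = row 0 G *m L by eexists.
have TX k : T ^+ k = invmx L *m A ^+ k *m L.
  elim: k => [|k IH]; first by rewrite !expr0 mulmx1 mulVmx.
  by rewrite !exprSr -!mulmxE IH TE -!mulmxA (mulKVmx Lu).
have sT : stablemx_pow T.
  have g : 0 <= mxnc (invmx L) * mxnc L by rewrite mulr_ge0 ?mxnc_ge0.
  apply: geodecay_le (geodecayZ g sA) => k; rewrite TX mulrAC.
  by apply: le_trans (mxncM _ _) _; rewrite ler_wpM2r ?mxnc_ge0// mxncM.
have cE : c^t* = invmx L *m e^t* by rewrite cE' adjmxM trmxCK.
have LL : L^t* *m (invmx L)^t* = 1%:M by rewrite -adjmxM mulVmx// adjmx1.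
have T1 : T *m T^t* = 1%:M - c^t* *m c.
  have -> : T *m T^t* = invmx L *m (A *m (L *m L^t*) *m A^t*) *m (invmx L)^t*.
    by rewrite TE !adjmxM !mulmxA.
  rewrite AX mulmxBr mulmxBl cE cE'; congr (_ - _); last by rewrite !mulmxA.
  by rewrite (mulKmx Lu) LL.
(* The adjoint of the [k]-th condition says that row [k] of [G] annihilates [L x^*], and [G] is
   invertible. *)
have obsT (x : 'rV_n.+1) : (forall k, x *m (T^t*) ^+ k *m b^t* = 0) -> x = 0.
  move=> h; suff : L *m x^t* = 0.
    by move=> /(congr1 (mulmx (invmx L))); rewrite mulmx0 mulKmx// => /(congr1 (fun Z => Z^t*)); rewrite trmxCK adjmx0.
  suff GL : G *m (L *m x^t*) = 0 by rewrite -(mulKmx Hu (L *m x^t*)) GL mulmx0.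
  apply/row_matrixP => i; rewrite row_mul row0.
  have := congr1 (fun Z => Z^t*) (h i); rewrite !adjmxM adjmxX !trmxCK adjmx0 TX.
  have -> : b *m (invmx L *m A ^+ i *m L *m x^t*) = row 0 (G *m A ^+ i) *m (L *m x^t*).
    by rewrite bE row_mul -!mulmxA (mulKVmx Lu).
  move=> <-; rewrite GA; congr mulmx.
  by rewrite GE; apply/rowP => j; rewrite !mxE add0n addn0 addnC.
have [P Pp PE] := stein_posdef (stable_adj sT) obsT.
exists T, P, b, c; split=> //.
- by split=> //; move: PE; rewrite !trmxCK.
- by rewrite TE !unitmx_mul unitmx_inv Lu andbT /= AE unitmx_mul unitmx_inv Hu.
- move=> k; rewrite TX cE bE -!mulmxA !(mulKVmx Lu) mulmxA.
  by rewrite -row_mul GA eE -colE !mxE.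
Qed.

End BalancedRealization.

(** * The torus of rotated realizations *)

Section SpectralFunction.
Variables (C : numClosedFieldType) (n : nat).
Implicit Types (S P : 'M[C]_n) (D : 'rV[C]_n).

Lemma spectral_diag_real S D P : S \is unitarymx -> P = S^t* *m diag_mx D *m S ->
  P^t* = P -> forall j, (D 0 j)^* = D 0 j.
Proof.
move=> Su PE Ph j; have DE : diag_mx D = S *m P *m S^t*.
  by rewrite PE !mulmxA (unitarymxP Su) mul1mx -mulmxA (unitarymxP Su) mulmx1.
have : (diag_mx D)^t* = diag_mx D by rewrite DE !adjmxM trmxCK Ph mulmxA.
by rewrite adjmx_diag => /matrixP/(_ j j); rewrite !mxE eqxx.
Qed.

Definition spectral_fun S D (f : C -> C) := S^t* *m diag_mx (\row_j f (D 0 j)) *m S.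

End SpectralFunction.

Section UnitarySpectralFunction.
Variables (C : numClosedFieldType) (n : nat).
Implicit Types (S P : 'M[C]_n.+1) (D : 'rV[C]_n.+1).

Lemma spectral_fun_unitary S D P f : S \is unitarymx -> P = S^t* *m diag_mx D *m S ->
  (forall z, `|f z| = 1) -> unitary_function P (spectral_fun S D f).
Proof.
move=> Su -> f1; rewrite /spectral_fun; split.
- rewrite !adjmxM trmxCK !mulmxA -(mulmxA _ S) (unitarymxP Su) mulmx1 adjmx_diag.
  rewrite -(mulmxA (S^t*)) mulmx_diag (_ : \row__ _ = const_mx 1) ?diag_const_mx ?mulmx1 ?unitarymx_adjK//.
  by apply/rowP => i; rewrite !mxE; exact: unimodular_conj.
- rewrite !mulmxA -(mulmxA _ S) -[in RHS](mulmxA _ S) (unitarymxP Su) !mulmx1.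
  by rewrite -!(mulmxA (S^t*)) !mulmx_diag; congr (_ *m (_ *m _)); congr diag_mx; apply/rowP => i; rewrite !mxE mulrC.
- move=> x s xP; exists (f s); first exact: f1.
  have yD : x *m S^t* *m diag_mx D = s *: (x *m S^t*).
    have /(congr1 (mulmx^~ (S^t*))) := xP; rewrite /= !mulmxA -scalemxAl.
    by rewrite -(mulmxA _ S) (unitarymxP Su) mulmx1.
  suff yf : x *m S^t* *m diag_mx (\row_j f (D 0 j)) = f s *: (x *m S^t*).
    by rewrite !mulmxA yf -scalemxAl -mulmxA unitarymx_adjK// mulmx1.
  (* A nonzero coordinate [j] of [x S^*] forces [D 0 j = s]. *)
  apply/rowP => j; have /rowP/(_ j) := yD; rewrite !mul_mx_diag !mxE; set w := \sum__ _.
  move=> /eqP; rewrite mulrC -subr_eq0 -mulrBl mulf_eq0 subr_eq0.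
  by move=> /orP[/eqP->|/eqP->]; rewrite ?mulr0 ?mul0r// mulrC.
Qed.

End UnitarySpectralFunction.

(** * Rational functions from balanced realizations *)

Section RationalFromBalanced.
Variables (R : realType) (n : nat).
Local Notation C := R[i].
Implicit Types (T P : 'M[C]_n.+1) (b c : 'rV[C]_n.+1).

Definition impulse T b c k : C := (b *m T ^+ k *m c^t*) 0 0.

(** This is det(1 - z T), whose zeros are the inverses of the nonzero eigenvalues of [T]. *)
Definition rev_char T : {poly C} := \poly_(j < n.+2) (char_poly T)`_(n.+1 - j).

Definition impulse_num T b c : {poly C} :=
  \poly_(k < n.+1) pconv (rev_char T) (impulse T b c) k.

Lemma impulse_conv T b c k : pconv (rev_char T) (impulse T b c) k = (impulse_num T b c)`_k.
Proof.
rewrite coef_poly; case: ltnP => // nk.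
rewrite (pconv_size _ (size_poly _ _))// (reindex_inj rev_ord_inj) /=.
transitivity ((b *m (\sum_(j < n.+2) (char_poly T)`_j *: T ^+ (j + (k - n.+1))) *m c^t*) 0 0).
  rewrite mulmx_sumr mulmx_suml summxE; apply: eq_bigr => j _.
  have jn : (j <= n.+1)%N by rewrite -ltnS.
  rewrite coef_poly subSS ltnS leq_subr subKn// -scalemxAr -scalemxAl mxE /impulse.
  by congr (_ * (_ *m T ^+ _ *m _) _ _); lia.
by rewrite Cayley_Hamilton_powers mulmx0 mul0mx mxE.
Qed.

Lemma rev_char0 T : (rev_char T)`_0 = 1.
Proof.
rewrite coef_poly /= subn0.
by have /monicP := char_poly_monic T; rewrite lead_coefE size_char_poly.
Qed.

Lemma rev_char_horner T z : z != 0 -> (rev_char T).[z] = z ^+ n.+1 * (char_poly T).[z^-1].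
Proof.
move=> z0; rewrite horner_poly (horner_coef_wide _ (_ : (_ <= n.+2)%N)) ?size_char_poly//.
rewrite mulr_sumr (reindex_inj rev_ord_inj); apply: eq_bigr => j _ /=.
have jn : (j <= n.+1)%N by rewrite -ltnS.
by rewrite subSS subKn// mulrCA exprVn; congr (_ * _); rewrite expfB_cond ?(negbTE z0)// addn0.
Qed.

(** The inverse of a zero in the closed disc would be an eigenvalue of modulus at least 1, hence
    exactly 1 for a contraction. *)
Lemma rev_char_stable T P b c z : balanced T P b c -> no_unimodular_eigenvalue T ->
  nc z <= 1 -> (rev_char T).[z] != 0.
Proof.
move=> [h1 _ _] nT z1; have [->|z0] := eqVneq z 0.
  by rewrite horner_coef0 rev_char0 oner_eq0.
rewrite rev_char_horner// mulf_neq0 ?expf_neq0//; apply/negP => rz.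
have /eigenvalueP[x xE xn0] : eigenvalue T z^-1 by rewrite eigenvalue_root_char.
have ge1 : 1 <= `|z^-1|.
  by rewrite normfV invf_ge1 ?normr_gt0// nc_norm -[1]/(1%:C%C) lecR.
have xx : 0 < (x *m x^t*) 0 0.
  rewrite lt_def mxdot_ge0 andbT; apply/eqP => /mxdot_eq0 x0.
  by rewrite x0 eqxx in xn0.
move/eqP: xn0; apply; apply: (nT x z^-1 _ xE).
apply/eqP; rewrite eq_le ge1 andbT -(@ler_pXn2r _ 2) ?nnegrE// expr1n.
rewrite -(ler_pM2r xx) mul1r.
have -> : `|z^-1| ^+ 2 * (x *m x^t*) 0 0 = (x *m (T *m T^t*) *m x^t*) 0 0.
  rewrite mulmxA xE -!scalemxAl -mulmxA -adjmxM xE adjmxZ -scalemxAr scalerA normCK.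
  by rewrite [in RHS]mxE.
rewrite h1 mulmxBr mulmx1 mulmxBl [X in X <= _]mxE gerDl [X in X <= _]mxE oppr_le0.
have -> : x *m (c^t* *m c) *m x^t* = (x *m c^t*) *m (x *m c^t*)^t*.
  by rewrite adjmxM trmxCK !mulmxA.
exact: mxdot_ge0.
Qed.

Definition obsmx T c : 'M[C]_n.+1 := \matrix_(i, j) (T ^+ j *m c^t*) i 0.
Definition ctrmx T b : 'M[C]_n.+1 := \matrix_(i, j) (b *m T ^+ i) 0 j.

Lemma impulse_hankelE T b c k :
  hankel n.+1 (impulse T b c) k = ctrmx T b *m T ^+ k *m obsmx T c.
Proof.
apply/matrixP => i j; rewrite !mxE /impulse addnAC exprD exprD -!mulmxE.
rewrite (mulmxA b) -[in LHS]mulmxA mxE; apply: eq_bigr => l _; rewrite [obsmx _ _ _ _]mxE.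
by congr (_ * _); rewrite (mulmxA b) !mxE; apply: eq_bigr => l' _; rewrite [ctrmx _ _ _ _]mxE.
Qed.

Lemma ctrmx_unit T P b c : balanced T P b c -> no_unimodular_eigenvalue T ->
  ctrmx T b \in unitmx.
Proof.
move=> bal nT; have Ku : (ctrmx T b)^t* \in unitmx.
  apply: unitmx_inj => x xK; apply: (balanced_controllable bal nT) => k kn.
  apply: mx11_eq0; have /rowP/(_ (Ordinal kn)) := xK; rewrite [in RHS]mxE => <-.
  rewrite -mulmxA -adjmxM !mxE; apply: eq_bigr => j _; rewrite !mxE.
  by congr (_ * _^*); apply: eq_bigr => l _.
by have := Ku; rewrite map_unitmx unitmx_tr.
Qed.

Lemma obsmx_unit T P b c : balanced T P b c -> no_unimodular_eigenvalue T ->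
  obsmx T c \in unitmx.
Proof.
move=> bal nT; apply: unitmx_inj => x xO; apply: (balanced_observable bal nT) => k kn.
apply: mx11_eq0; have /rowP/(_ (Ordinal kn)) := xO; rewrite [in RHS]mxE => <-.
by rewrite -mulmxA !mxE; apply: eq_bigr => j _; rewrite !mxE.
Qed.

Lemma impulse_hankel_unit T P b c : balanced T P b c -> no_unimodular_eigenvalue T ->
  hankel n.+1 (impulse T b c) 0 \in unitmx.
Proof.
move=> bal nT; rewrite impulse_hankelE expr0 mulmx1 unitmx_mul.
by rewrite (ctrmx_unit bal nT) (obsmx_unit bal nT).
Qed.

(** The outer factors of the Hankel factorization are invertible, so the decay of the Hankel
    matrices passes to the powers of [T]; no spectral radius formula is involved. *)
Lemma impulse_stable T P b c : balanced T P b c -> no_unimodular_eigenvalue T ->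
  geodecay (fun k => nc (impulse T b c k)) -> stablemx_pow T.
Proof.
move=> bal nT /(geodecay_hankel n) g.
have s0 : 0 <= mxnc (invmx (ctrmx T b)) * mxnc (invmx (obsmx T c)).
  by rewrite mulr_ge0 ?mxnc_ge0.
apply: geodecay_le (geodecayZ s0 g) => k.
have -> : T ^+ k = invmx (ctrmx T b) *m hankel n.+1 (impulse T b c) k *m invmx (obsmx T c).
  rewrite impulse_hankelE -(mulmxA (ctrmx T b)) (mulKmx (ctrmx_unit bal nT)).
  by rewrite (mulmxK (obsmx_unit bal nT)).
rewrite (le_trans (mxncM _ _))// mulrAC ler_wpM2r ?mxnc_ge0//; exact: mxncM.
Qed.

Lemma impulse_Vd d T P b c : uphalf d = n.+1 -> balanced T P b c ->
  no_unimodular_eigenvalue T -> (T \in unitmx) = ~~ odd d ->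
  Vd_repr d (impulse_num T b c) (rev_char T) (impulse T b c).
Proof.
move=> dn bal nT Td; apply: Vd_of_hankel.
- exact: impulse_conv.
- exact: rev_char0.
- by move=> z; exact: rev_char_stable bal nT.
- by rewrite dn size_poly.
- by rewrite dn size_poly.
- by rewrite dn (impulse_hankel_unit bal nT).
(* The top coefficient of [rev_char T] is the determinant of [T] up to sign. *)
- rewrite dn coef_poly ltnSn subnn.
  have -> : (char_poly T)`_0 = (-1) ^+ n.+1 * \det T by exact: char_poly_det.
  rewrite mulf_eq0 signr_eq0 /=; move: Td; rewrite unitmxE unitfE.
  by move=> /(congr1 negb); rewrite !negbK.
Qed.

End RationalFromBalanced.

Section Torus.
Variables (R : realType) (n : nat).
Local Notation C := R[i].
Variables (T P : 'M[C]_n.+1) (b c : 'rV[C]_n.+1) (S1 S2 : 'M[C]_n.+1) (p q : 'rV[C]_n.+1).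
Hypothesis bal : balanced T P b c.
Hypothesis sT : stablemx_pow T.
Hypothesis S1u : S1 \is unitarymx.
Hypothesis S2u : S2 \is unitarymx.
Hypothesis PE : P = S1^t* *m diag_mx p *m S1.
Hypothesis QE : P - b^t* *m b = S2^t* *m diag_mx q *m S2.

Definition cis (x : R) : C := (cos x +i* sin x)%C.

Lemma cis_norm x : `|cis x| = 1.
Proof. by rewrite nc_norm /= cos2Dsin2 sqrtr1. Qed.

(* Equal eigenvalues share the same angle, so that the rotations are functions of [P] and
   [P - b^* b]. *)
Definition eig_index (D : 'rV[C]_n.+1) (s : C) : 'I_n.+1 :=
  odflt ord0 [pick j | D 0 j == s].

Lemma eig_indexK (D : 'rV[C]_n.+1) j : D 0 (eig_index D (D 0 j)) = D 0 j.
Proof. by rewrite /eig_index; case: pickP => [k /eqP//|/(_ j)]; rewrite eqxx. Qed.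

Implicit Types theta : 'rV[R]_(n.+1 + n.+1).

(** The signs of the angles in [rotU] and [rotV] are opposite so that, at [t] times the
    [frequencies], the rotations are exp(-itP) and exp(it(P - b^* b)). *)
Definition rotU theta :=
  spectral_fun S1 p (fun s => cis (- theta 0 (lshift n.+1 (eig_index p s)))).

Definition rotV theta :=
  spectral_fun S2 q (fun s => cis (theta 0 (rshift n.+1 (eig_index q s)))).

Definition torus_T theta := T *m rotV theta *m rotU theta.
Definition torus_b theta := b *m rotU theta.
Definition torus_map theta := impulse (torus_T theta) (torus_b theta) c.

Definition frequencies : 'rV[R]_(n.+1 + n.+1) :=
  row_mx (map_mx (@complex.Re R) p) (map_mx (@complex.Re R) q).

Lemma rotU_fun theta : unitary_function P (rotU theta).
Proof. by apply: spectral_fun_unitary PE _ => // s; exact: cis_norm. Qed.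

Lemma rotV_fun theta : unitary_function (P - b^t* *m b) (rotV theta).
Proof. by apply: spectral_fun_unitary QE _ => // s; exact: cis_norm. Qed.

Lemma torus_balanced theta : balanced (torus_T theta) P (torus_b theta) c.
Proof. exact: balanced_rotation bal (rotU_fun _) (rotV_fun _). Qed.

Lemma torus_no_unimodular theta : no_unimodular_eigenvalue (torus_T theta).
Proof.
exact: rotation_no_unimodular bal (rotU_fun _) (rotV_fun _) (stable_no_unimodular sT).
Qed.

Lemma torus_Vd d theta : uphalf d = n.+1 -> (T \in unitmx) = ~~ odd d ->
  Vd_repr d (impulse_num (torus_T theta) (torus_b theta) c) (rev_char (torus_T theta))
    (torus_map theta).
Proof.
move=> dn Td; apply: (impulse_Vd dn (torus_balanced theta) (@torus_no_unimodular theta)).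
rewrite unitmx_mul (unitmx_mul T) Td.
have [/mulmx1_unit[Uu _] _ _] := rotU_fun theta.
have [/mulmx1_unit[Vu _] _ _] := rotV_fun theta.
by rewrite Uu Vu !andbT.
Qed.

Lemma torus_stable d theta : uphalf d = n.+1 -> (T \in unitmx) = ~~ odd d ->
  stablemx_pow (torus_T theta).
Proof.
move=> dn Td; apply: impulse_stable (torus_balanced theta) (@torus_no_unimodular theta) _.
apply: (@Vd_geodecay R d); exists (impulse_num (torus_T theta) (torus_b theta) c).
by exists (rev_char (torus_T theta)); exact: torus_Vd.
Qed.

End Torus.

(** * Trigonometric polynomials *)

Section TrigPolynomials.
Local Open Scope classical_set_scope.
Variables (R : realType) (N : nat).
Local Notation V := 'rV[R]_N.
Local Notation C := R[i].

(** A syntactic class of continuous functions that contains its own directional derivatives, so that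
    smoothness of every order is an induction on the order. *)
Inductive trigpoly : (V -> R) -> Prop :=
| trig_cst a : trigpoly (fun=> a)
| trig_cos j : trigpoly (fun x => cos (x 0 j))
| trig_sin j : trigpoly (fun x => sin (x 0 j))
| trigD f g : trigpoly f -> trigpoly g -> trigpoly (fun x => f x + g x)
| trigM f g : trigpoly f -> trigpoly g -> trigpoly (fun x => f x * g x).

Lemma is_derive_line (f : V -> R) x v df :
  is_derive (0 : R) 1 (fun h : R => f (h *: v + x)) df -> is_derive x v f df.
Proof.
have E : (fun h : R => h^-1 *: (((fun k : R => f (k *: v + x)) \o shift 0) (h *: 1) - f (0 *: v + x)))
  = (fun h : R => h^-1 *: ((f \o shift x) (h *: v) - f x)).
  by apply/funext => h /=; rewrite addr0 scale0r add0r [h *: 1]mulr1.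
move=> [D1 D2]; split; first by move: D1; rewrite /derivable E.
by move: D2; rewrite /derive E.
Qed.

Lemma is_derive_affine (a b : R) (g : R -> R) dg :
  is_derive b 1 g dg -> is_derive (0 : R) 1 (fun h : R => g (h * a + b)) (dg * a).
Proof.
move=> Dg; have Dl : is_derive (0 : R) 1 (fun h : R => h * a + b) a.
  rewrite (_ : (fun h => _) = (a \*: id) + cst b); last first.
    by apply/funext => h; rewrite /GRing.add /= /GRing.scale /= mulrC.
  by apply: is_derive_eq; rewrite addr0 [_ *: _]mulr1.
apply: (@is_derive1_comp R g (fun h : R => h * a + b) 0 dg a).
by rewrite mul0r add0r.
Qed.

Lemma trig_derive f : trigpoly f ->
  forall v, exists2 df, trigpoly df & forall x, is_derive x v f (df x).
Proof.
elim=> [a|j|j|{}f g _ IHf _ IHg|{}f g f_trig IHf g_trig IHg] v.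
- exists (fun=> 0); first exact: trig_cst.
  by move=> x; exact: is_derive_cst.
- exists (fun x => -1 * (sin (x 0 j) * v 0 j)).
    by do !apply: trigM; exact: trig_cst || exact: trig_sin.
  move=> x; apply: is_derive_line; rewrite mulN1r -mulNr.
  rewrite (_ : (fun h => _) = (fun h : R => cos (h * v 0 j + x 0 j))); last first.
    by apply/funext => h; rewrite !mxE.
  exact: is_derive_affine.
- exists (fun x => cos (x 0 j) * v 0 j).
    by apply: trigM; [exact: trig_cos|exact: trig_cst].
  move=> x; apply: is_derive_line.
  rewrite (_ : (fun h => _) = (fun h : R => sin (h * v 0 j + x 0 j))); last first.
    by apply/funext => h; rewrite !mxE.
  exact: is_derive_affine.
- have [df tf Df] := IHf v; have [dg tg Dg] := IHg v.
  exists (fun x => df x + dg x); first exact: trigD.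
  by move=> x; have := Df x; have := Dg x => Dgx Dfx; exact: (@is_deriveD _ _ _ f g x v _ _ Dfx Dgx).
- have [df tf Df] := IHf v; have [dg tg Dg] := IHg v.
  exists (fun x => f x * dg x + g x * df x).
    by apply: trigD; apply: trigM.
  by move=> x; exact: (@is_deriveM _ _ f g x v _ _ (Df x) (Dg x)).
Qed.

Lemma trig_continuous f : trigpoly f -> continuous f.
Proof.
elim=> [a|j|j|{}f g _ IHf _ IHg|{}f g _ IHf _ IHg] x.
- exact: cst_continuous.
- apply: (@continuous_comp _ _ _ (fun x : V => x 0 j) (@cos R)).
    exact: coord_continuous.
  exact: continuous_cos.
- apply: (@continuous_comp _ _ _ (fun x : V => x 0 j) (@sin R)).
    exact: coord_continuous.
  exact: continuous_sin.
- exact: (@continuousD _ _ _ f g x (IHf x) (IHg x)).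
- exact: (@continuousM _ _ f g x (IHf x) (IHg x)).
Qed.

Lemma trig_smooth f : trigpoly f -> smooth f.
Proof.
move=> tf k; elim: k f tf => [|k IH] f tf /=; first exact: trig_continuous.
split=> [x v|v]; have [df tdf Df] := trig_derive tf v; first by have [] := Df x.
rewrite (_ : (fun x => _) = df); first exact: IH.
by apply/funext => x; have [_ ->] := Df x.
Qed.

Definition ctrig (f : V -> C) :=
  trigpoly (fun x => complex.Re (f x)) /\ trigpoly (fun x => complex.Im (f x)).

Lemma ctrig_smooth f : ctrig f -> smoothC f.
Proof. by move=> [h1 h2]; split; exact: trig_smooth. Qed.

Lemma ctrig_cst a : ctrig (fun=> a).
Proof. by split; exact: trig_cst. Qed.

Lemma ctrigD f g : ctrig f -> ctrig g -> ctrig (fun x => f x + g x).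
Proof.
move=> [f1 f2] [g1 g2]; split.
- rewrite (_ : (fun x => _) = (fun x => complex.Re (f x) + complex.Re (g x))); first exact: trigD.
  by apply/funext => x; case: (f x) (g x) => ? ? [].
- rewrite (_ : (fun x => _) = (fun x => complex.Im (f x) + complex.Im (g x))); first exact: trigD.
  by apply/funext => x; case: (f x) (g x) => ? ? [].
Qed.

Lemma ctrigM f g : ctrig f -> ctrig g -> ctrig (fun x => f x * g x).
Proof.
move=> [f1 f2] [g1 g2]; split.
- rewrite (_ : (fun x => _) = (fun x => complex.Re (f x) * complex.Re (g x) + -1 * (complex.Im (f x) * complex.Im (g x)))).
    by apply: trigD; [|apply: trigM; first exact: trig_cst]; apply: trigM.
  by apply/funext => x; case: (f x) (g x) => ? ? [? ?] /=; rewrite mulN1r.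
- rewrite (_ : (fun x => _) = (fun x => complex.Re (f x) * complex.Im (g x) + complex.Im (f x) * complex.Re (g x))).
    by apply: trigD; apply: trigM.
  by apply/funext => x; case: (f x) (g x) => ? ? [? ?].
Qed.

Lemma ctrig_sum I (r : seq I) (Q : pred I) (F : I -> V -> C) :
  (forall i, ctrig (F i)) -> ctrig (fun x => \sum_(i <- r | Q i) F i x).
Proof.
move=> h; elim: r => [|i r IH].
  by rewrite (_ : (fun x => _) = fun=> 0); [exact: ctrig_cst|apply/funext => x; rewrite big_nil].
case: (boolP (Q i)) => Qi.
  rewrite (_ : (fun x => _) = (fun x => F i x + \sum_(i <- r | Q i) F i x)); first exact: ctrigD.
  by apply/funext => x; rewrite big_cons Qi.
rewrite (_ : (fun x => _) = (fun x => \sum_(i <- r | Q i) F i x))//.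
by apply/funext => x; rewrite big_cons (negbTE Qi).
Qed.

Lemma ctrig_cis j : ctrig (fun x => cis (x 0 j)).
Proof. by split; [exact: trig_cos|exact: trig_sin]. Qed.

Lemma ctrig_cisN j : ctrig (fun x => cis (- x 0 j)).
Proof.
split=> /=.
- rewrite (_ : (fun x => _) = (fun x : V => cos (x 0 j))); first exact: trig_cos.
  by apply/funext => x; rewrite cosN.
- rewrite (_ : (fun x => _) = (fun x : V => -1 * sin (x 0 j))).
    by apply: trigM; [exact: trig_cst|exact: trig_sin].
  by apply/funext => x; rewrite sinN mulN1r.
Qed.

Definition mxtrig m n (F : V -> 'M[C]_(m, n)) := forall i j, ctrig (fun x => F x i j).

Lemma mxtrig_cst m n (A : 'M[C]_(m, n)) : mxtrig (fun=> A).
Proof. by move=> i j; exact: ctrig_cst. Qed.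

Lemma mxtrigM m n p (F : V -> 'M[C]_(m, n)) (G : V -> 'M[C]_(n, p)) :
  mxtrig F -> mxtrig G -> mxtrig (fun x => F x *m G x).
Proof.
move=> hF hG i j.
rewrite (_ : (fun x => _) = (fun x => \sum_k F x i k * G x k j)).
  by apply: ctrig_sum => k; apply: ctrigM.
by apply/funext => x; rewrite mxE.
Qed.

Lemma mxtrigX n (F : V -> 'M[C]_n.+1) k : mxtrig F -> mxtrig (fun x => F x ^+ k).
Proof.
move=> hF; elim: k => [|k IH].
  by rewrite (_ : (fun x => _) = fun=> 1); [exact: mxtrig_cst|apply/funext].
rewrite (_ : (fun x => _) = (fun x => F x *m F x ^+ k)); first exact: mxtrigM.
by apply/funext => x; rewrite exprS.
Qed.

Lemma mxtrig_diag n (F : 'I_n -> V -> C) : (forall j, ctrig (F j)) ->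
  mxtrig (fun x => diag_mx (\row_j F j x)).
Proof.
move=> hF i j; rewrite (_ : (fun x => _) = (fun x => (i == j)%:R * F i x)).
  by apply: ctrigM => //; exact: ctrig_cst.
by apply/funext => x; rewrite !mxE mulr_natl.
Qed.

Definition polytrig (p : V -> {poly C}) := forall k, ctrig (fun x => (p x)`_k).

Lemma polytrig_cst p : polytrig (fun=> p).
Proof. by move=> k; exact: ctrig_cst. Qed.

Lemma polytrigC f : ctrig f -> polytrig (fun x => (f x)%:P).
Proof.
move=> hf k; case: k => [|k].
  by rewrite (_ : (fun x => _) = f)//; apply/funext => x; rewrite coefC.
by rewrite (_ : (fun x => _) = fun=> 0); [exact: ctrig_cst|apply/funext => x; rewrite coefC].
Qed.

Lemma polytrigD p q : polytrig p -> polytrig q -> polytrig (fun x => p x + q x).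
Proof.
move=> hp hq k; rewrite (_ : (fun x => _) = (fun x => (p x)`_k + (q x)`_k)); first exact: ctrigD.
by apply/funext => x; rewrite coefD.
Qed.

Lemma polytrigM p q : polytrig p -> polytrig q -> polytrig (fun x => p x * q x).
Proof.
move=> hp hq k.
rewrite (_ : (fun x => _) = (fun x => \sum_(j < k.+1) (p x)`_j * (q x)`_(k - j))).
  by apply: ctrig_sum => j; exact: ctrigM.
by apply/funext => x; rewrite coefM.
Qed.

Lemma polytrig_prod I (r : seq I) (p : I -> V -> {poly C}) :
  (forall i, polytrig (p i)) -> polytrig (fun x => \prod_(i <- r) p i x).
Proof.
move=> h; elim: r => [|i r IH].
  by rewrite (_ : (fun x => _) = fun=> 1); [exact: polytrig_cst|apply/funext => x; rewrite big_nil].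
rewrite (_ : (fun x => _) = (fun x => p i x * \prod_(i <- r) p i x)); first exact: polytrigM.
by apply/funext => x; rewrite big_cons.
Qed.

Lemma polytrig_sum I (r : seq I) (p : I -> V -> {poly C}) :
  (forall i, polytrig (p i)) -> polytrig (fun x => \sum_(i <- r) p i x).
Proof.
move=> h; elim: r => [|i r IH].
  by rewrite (_ : (fun x => _) = fun=> 0); [exact: polytrig_cst|apply/funext => x; rewrite big_nil].
rewrite (_ : (fun x => _) = (fun x => p i x + \sum_(i <- r) p i x)); first exact: polytrigD.
by apply/funext => x; rewrite big_cons.
Qed.

Lemma polytrig_char_poly n (F : V -> 'M[C]_n) : mxtrig F -> polytrig (fun x => char_poly (F x)).
Proof.
move=> hF.
rewrite (_ : (fun x => _) = (fun x => \sum_(s : 'S_n) (-1) ^+ s * \prod_i (('X *+ (i == s i)) + (-1)%:P * (F x i (s i))%:P))).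
  apply: polytrig_sum => s; apply: polytrigM; first exact: polytrig_cst.
  apply: polytrig_prod => i; apply: polytrigD; first exact: polytrig_cst.
  by apply: polytrigM; [exact: polytrig_cst|exact: polytrigC].
apply/funext => x; rewrite /char_poly /determinant; apply: eq_bigr => s _; congr (_ * _).
by apply: eq_bigr => i _; rewrite !mxE -polyCM mulN1r polyCN.
Qed.

Lemma ctrig_impulse n (T : V -> 'M[C]_n.+1) (b : V -> 'rV[C]_n.+1) c k :
  mxtrig T -> mxtrig b -> ctrig (fun x => impulse (T x) (b x) c k).
Proof.
move=> hT hb; apply: (mxtrigM (F := fun x => b x *m T x ^+ k) (G := fun=> c^t*)).
  by apply: mxtrigM => //; exact: mxtrigX.
exact: mxtrig_cst.
Qed.

Lemma polytrig_rev_char n (T : V -> 'M[C]_n.+1) : mxtrig T -> polytrig (fun x => rev_char (T x)).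
Proof.
move=> hT k; have [kn|kn] := ltnP k n.+2; last first.
  rewrite (_ : (fun x => _) = fun=> 0); first exact: ctrig_cst.
  by apply/funext => x; rewrite coef_poly ltnNge kn.
rewrite (_ : (fun x => _) = (fun x => (char_poly (T x))`_(n.+1 - k))).
  exact: polytrig_char_poly.
by apply/funext => x; rewrite coef_poly kn.
Qed.

Lemma polytrig_impulse_num n (T : V -> 'M[C]_n.+1) (b : V -> 'rV[C]_n.+1) c :
  mxtrig T -> mxtrig b -> polytrig (fun x => impulse_num (T x) (b x) c).
Proof.
move=> hT hb k; have [kn|kn] := ltnP k n.+1; last first.
  rewrite (_ : (fun x => _) = fun=> 0); first exact: ctrig_cst.
  by apply/funext => x; rewrite coef_poly ltnNge kn.
rewrite (_ : (fun x => _) = (fun x => \sum_(j < k.+1) (rev_char (T x))`_j * impulse (T x) (b x) c (k - j)%N)).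
  by apply: ctrig_sum => j; apply: ctrigM; [exact: polytrig_rev_char|exact: ctrig_impulse].
by apply/funext => x; rewrite coef_poly kn.
Qed.

End TrigPolynomials.

Section TorusTrig.
Local Open Scope classical_set_scope.
Variables (R : realType) (n : nat).
Local Notation C := R[i].
Variables (T : 'M[C]_n.+1) (b c : 'rV[C]_n.+1) (S1 S2 : 'M[C]_n.+1) (p q : 'rV[C]_n.+1).

Lemma mxtrig_spectral m (S : 'M[C]_m) (D : 'rV[C]_m) N (f : 'rV[R]_N -> C -> C) :
  (forall s, ctrig (fun x => f x s)) -> mxtrig (fun x => spectral_fun S D (f x)).
Proof.
move=> hf; pose F x := diag_mx (\row_j f x (D 0 j)).
have hF : mxtrig F by apply: mxtrig_diag => j; exact: hf.
exact: mxtrigM (mxtrigM (mxtrig_cst _ (S^t*)) hF) (mxtrig_cst _ S).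
Qed.

Lemma mxtrig_rotU : mxtrig (rotU S1 p).
Proof. by apply: mxtrig_spectral => s; exact: ctrig_cisN. Qed.

Lemma mxtrig_rotV : mxtrig (rotV S2 q).
Proof. by apply: mxtrig_spectral => s; exact: ctrig_cis. Qed.

Lemma mxtrig_torus_T : mxtrig (torus_T T S1 S2 p q).
Proof. exact: mxtrigM (mxtrigM (mxtrig_cst _ T) mxtrig_rotV) mxtrig_rotU. Qed.

Lemma mxtrig_torus_b : mxtrig (torus_b b S1 p).
Proof. exact: mxtrigM (mxtrig_cst _ b) mxtrig_rotU. Qed.

Lemma torus_coord_trig k : ctrig (fun x => torus_map T b c S1 S2 p q x k).
Proof. exact: ctrig_impulse mxtrig_torus_T mxtrig_torus_b. Qed.

Lemma torus_map_cis (theta eta : 'rV[R]_(n.+1 + n.+1)) : (forall j, cis (theta 0 j) = cis (eta 0 j)) ->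
  torus_map T b c S1 S2 p q theta = torus_map T b c S1 S2 p q eta.
Proof.
move=> h; have h' j : cis (- theta 0 j) = cis (- eta 0 j).
  by have [] := h j; rewrite /cis !cosN !sinN => -> ->.
apply/funext => k; rewrite /torus_map /torus_T /torus_b.
have -> : rotU S1 p theta = rotU S1 p eta.
  by congr (_ *m diag_mx _ *m _); apply/rowP => j; rewrite !mxE h'.
suff -> : rotV S2 q theta = rotV S2 q eta by [].
by congr (_ *m diag_mx _ *m _); apply/rowP => j; rewrite !mxE h.
Qed.

Lemma torus_periodic theta (j : 'I_(n.+1 + n.+1)) :
  torus_map T b c S1 S2 p q (theta + (2 * pi) *: delta_mx 0 j) =
  torus_map T b c S1 S2 p q theta.
Proof.
apply: torus_map_cis => i; rewrite !mxE eqxx /=; case: (i == j).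
  by rewrite mulr1 mulr_natl /cis cosD2pi sinD2pi.
by rewrite mulr0 addr0.
Qed.

End TorusTrig.

(** * The rotated realizations solve the equation *)

Section ComplexDerivative.
Local Open Scope classical_set_scope.
Variable R : realType.
Local Notation C := R[i].

Definition cderiv (f : R -> C) (t : R) (a : C) :=
  is_derive t (1 : R) (fun s => complex.Re (f s)) (complex.Re a) /\
  is_derive t (1 : R) (fun s => complex.Im (f s)) (complex.Im a).

Lemma cderiv_cst (a : C) t : cderiv (fun=> a) t 0.
Proof. by split; exact: is_derive_cst. Qed.

Lemma cderivD f g t a b : cderiv f t a -> cderiv g t b -> cderiv (fun s => f s + g s) t (a + b).
Proof.
move=> [f1 f2] [g1 g2]; split.
- rewrite (_ : (fun s => _) = (fun s => complex.Re (f s)) + (fun s => complex.Re (g s))).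
    by apply: is_derive_eq; case: a b {f1 f2 g1 g2} => ? ? [].
  by apply/funext => s; rewrite /GRing.add /=; case: (f s) (g s) => ? ? [].
- rewrite (_ : (fun s => _) = (fun s => complex.Im (f s)) + (fun s => complex.Im (g s))).
    by apply: is_derive_eq; case: a b {f1 f2 g1 g2} => ? ? [].
  by apply/funext => s; rewrite /GRing.add /=; case: (f s) (g s) => ? ? [].
Qed.

Lemma cderivM f g t a b : cderiv f t a -> cderiv g t b ->
  cderiv (fun s => f s * g s) t (a * g t + f t * b).
Proof.
move=> [f1 f2] [g1 g2]; split.
- rewrite (_ : (fun s => _) = (fun s => complex.Re (f s)) * (fun s => complex.Re (g s))
      - (fun s => complex.Im (f s)) * (fun s => complex.Im (g s))).
    apply: is_derive_eq; case: a b (f t) (g t) {f1 f2 g1 g2} => ? ? [? ?] [? ?] [? ?] /=.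
    by rewrite /GRing.scale /=; ring.
  by apply/funext => s; rewrite /GRing.add /GRing.opp /GRing.mul /=; case: (f s) (g s) => ? ? [].
- rewrite (_ : (fun s => _) = (fun s => complex.Re (f s)) * (fun s => complex.Im (g s))
      + (fun s => complex.Im (f s)) * (fun s => complex.Re (g s))).
    apply: is_derive_eq; case: a b (f t) (g t) {f1 f2 g1 g2} => ? ? [? ?] [? ?] [? ?] /=.
    by rewrite /GRing.scale /=; ring.
  by apply/funext => s; rewrite /GRing.add /GRing.opp /GRing.mul /=; case: (f s) (g s) => ? ? [].
Qed.

Lemma cderiv_sum I (r : seq I) (F : I -> R -> C) (D : I -> C) t :
  (forall i, cderiv (F i) t (D i)) ->
  cderiv (fun s => \sum_(i <- r) F i s) t (\sum_(i <- r) D i).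
Proof.
move=> h; elim: r => [|i r IH].
  rewrite big_nil (_ : (fun s => _) = fun=> 0); first exact: cderiv_cst.
  by apply/funext => s; rewrite big_nil.
rewrite big_cons (_ : (fun s => _) = (fun s => F i s + \sum_(i <- r) F i s)).
  exact: cderivD.
by apply/funext => s; rewrite big_cons.
Qed.

Lemma cderiv_cis (a t : R) : cderiv (fun s => cis (s * a)) t ('i * a%:C%C * cis (t * a)).
Proof.
have D : is_derive t (1 : R) (fun s : R => s * a) a.
  rewrite (_ : (fun s => _) = a \*: id); last by apply/funext => s; rewrite /GRing.scale /= mulrC.
  by apply: is_derive_eq; rewrite [_ *: _]mulr1.
have -> : 'i * a%:C%C * cis (t * a) = Complex (- sin (t * a) * a) (cos (t * a) * a).
  by rewrite -complexiE; apply/eqP; rewrite eq_complex /=; apply/andP; split; apply/eqP; ring.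
split => /=.
- exact: (@is_derive1_comp R cos (fun s : R => s * a) t _ a).
- exact: (@is_derive1_comp R sin (fun s : R => s * a) t _ a).
Qed.

Definition mxderiv m n (F : R -> 'M[C]_(m, n)) t (D : 'M[C]_(m, n)) := forall i j, cderiv (fun s => F s i j) t (D i j).

Lemma mxderiv_cst m n (A : 'M[C]_(m, n)) t : mxderiv (fun=> A) t 0.
Proof.
move=> i j; rewrite [X in cderiv _ _ X](_ : _ = 0); last by rewrite mxE.
exact: cderiv_cst.
Qed.

Lemma mxderivM m n p (F : R -> 'M[C]_(m, n)) (G : R -> 'M[C]_(n, p)) t D E :
  mxderiv F t D -> mxderiv G t E -> mxderiv (fun s => F s *m G s) t (D *m G t + F t *m E).
Proof.
move=> hF hG i j; rewrite !mxE -big_split /=.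
rewrite (_ : (fun s => _) = (fun s => \sum_k F s i k * G s k j)).
  by apply: cderiv_sum => k; exact: cderivM.
by apply/funext => s; rewrite mxE.
Qed.

End ComplexDerivative.

Section TorusFlow.
Local Open Scope classical_set_scope.
Variables (R : realType) (n : nat).
Local Notation C := R[i].

(** The derivative of exp(i eps t P); [eps] is -1 for the rotation built on [P] and 1 for the one
    built on [P - b^* b]. *)
Lemma mxderiv_spectral (S P : 'M[C]_n.+1) (D : 'rV[C]_n.+1) (a : 'I_n.+1 -> R) (eps : C)
    (U : R -> 'M[C]_n.+1) t :
  S \is unitarymx -> P = S^t* *m diag_mx D *m S -> (forall j, (a j)%:C%C = eps * D 0 j) ->
  (forall s, U s = S^t* *m diag_mx (\row_j cis (s * a j)) *m S) ->
  mxderiv U t (('i * eps) *: (U t *m P)).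
Proof.
move=> Su -> aD /funext ->.
have hD : mxderiv (fun s => diag_mx (\row_j cis (s * a j))) t
    (diag_mx (\row_j ('i * (a j)%:C%C * cis (t * a j)))).
  move=> i j; rewrite [X in cderiv _ _ X](_ : _ = (i == j)%:R * ('i * (a i)%:C%C * cis (t * a i))).
    rewrite (_ : (fun s => _) = (fun s => (i == j)%:R * cis (s * a i))).
      have := cderivM (cderiv_cst ((i == j)%:R : C) t) (cderiv_cis (a i) t).
      by rewrite mul0r add0r.
    by apply/funext => s; rewrite !mxE mulr_natl.
  by rewrite !mxE mulr_natl.
have := mxderivM (mxderivM (mxderiv_cst (S^t*) t) hD) (mxderiv_cst S t).
rewrite mul0mx add0r mulmx0 addr0; congr mxderiv.
have -> : diag_mx (\row_j ('i * (a j)%:C%C * cis (t * a j))) =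
    ('i * eps) *: (diag_mx (\row_j cis (t * a j)) *m diag_mx D).
  apply/matrixP => i j; rewrite mulmx_diag !mxE aD; case: (i == j); last by rewrite !mulr0n mulr0.
  by rewrite !mulr1n; ring.
rewrite -scalemxAr -scalemxAl; congr (_ *: _).
by rewrite -!mulmxA (mulmxA S (S^t*)) (unitarymxP Su) mul1mx.
Qed.

(** A telescoping sum with its exact remainder. It is used with [A = T], [X = 1], [w = c] and with
    [A = T^*], [X = P], [w = b]. *)
Lemma stein_partial_sum (A X : 'M[C]_n.+1) (w : 'rV[C]_n.+1) N :
  A *m X *m A^t* = X - w^t* *m w ->
  \sum_(l < N) A ^+ l *m (w^t* *m w) *m (A ^+ l)^t* = X - A ^+ N *m X *m (A ^+ N)^t*.
Proof.
move=> h; elim: N => [|N IH].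
  by rewrite big_ord0 expr0 adjmx1 mul1mx mulmx1 subrr.
rewrite big_ord_recr /= IH (_ : w^t* *m w = X - A *m X *m A^t*); last by rewrite h subKr.
rewrite mulmxBr mulmxBl addrA subrK exprSr -mulmxE adjmxM.
by rewrite -!mulmxA.
Qed.

Variables (T P : 'M[C]_n.+1) (b c : 'rV[C]_n.+1).
Local Notation y := (impulse T b c).

(** For a stable balanced realization this is the coefficient of Pi(|u|^2 u). Up to the factor -i it
    is also what the product rule gives for [b T^k c^*] when [b' = -i b P] and [T' = -i T b^* b]. *)
Definition szego_field (T P : 'M[C]_n.+1) (b c : 'rV[C]_n.+1) k : C :=
  (b *m P *m T ^+ k *m c^t*) 0 0 +
  \sum_(j < k) (b *m T ^+ (k - j) *m b^t*) 0 0 * impulse T b c j.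

(** The part of [szego_field] missed by the first [N] terms of the nonlinearity; each summand stems
    from the remainder of a telescoped series. *)
Definition szego_rest k N : C :=
  \sum_(j < k) (b *m T ^+ (k - j) *m T ^+ N *m (T ^+ N)^t* *m b^t*) 0 0 * y j +
  ((b *m (T ^+ N)^t* *m P *m T ^+ N *m T ^+ k *m c^t*) 0 0 +
   \sum_(e < N) y (k + e)%N * (b *m T ^+ (N - e) *m (T ^+ N)^t* *m b^t*) 0 0).

Hypothesis bal : balanced T P b c.

Lemma mx11M (A B : 'M[C]_1) : A 0 0 * B 0 0 = (A *m B) 0 0.
Proof. by rewrite mxE big_ord1. Qed.

Lemma conj_impulse l : (y l)^* = (c *m (T ^+ l)^t* *m b^t*) 0 0.
Proof.
rewrite /impulse -[LHS]/((fun z => z^*) _).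
have -> : ((b *m T ^+ l *m c^t*) 0 0)^* = ((b *m T ^+ l *m c^t*)^t*) 0 0 by rewrite [RHS]mxE [in RHS]mxE.
by rewrite !adjmxM trmxCK mulmxA.
Qed.

Lemma impulse_correlation N m :
  \sum_(l < N) (y l)^* * y (l + m)%N =
  (b *m T ^+ m *m b^t*) 0 0 - (b *m T ^+ m *m T ^+ N *m (T ^+ N)^t* *m b^t*) 0 0.
Proof.
have [h1 _ _] := bal.
have h : T *m 1%:M *m T^t* = 1%:M - c^t* *m c by rewrite mulmx1.
have := congr1 (fun Z => (b *m T ^+ m *m Z *m b^t*) 0 0) (stein_partial_sum N h).
rewrite mulmx1 mulmxBr mulmxBl mulmx1 !mulmxA => e.
transitivity ((b *m T ^+ m *m b^t* - b *m T ^+ m *m T ^+ N *m (T ^+ N)^t* *m b^t*) 0 0); last first.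
  by rewrite [LHS]mxE; congr (_ + _); rewrite [LHS]mxE.
rewrite -e mulmx_sumr mulmx_suml summxE; apply: eq_bigr => l _.
rewrite conj_impulse mulrC /impulse mx11M addnC exprD -mulmxE.
by congr (fun_of_matrix _ 0 0); rewrite !mulmxA.
Qed.

Lemma impulse_correlation_conj N e :
  \sum_(m < N) (y (m + e)%N)^* * y m =
  (b *m (T ^+ e)^t* *m b^t*) 0 0 - (b *m T ^+ N *m (T ^+ (e + N))^t* *m b^t*) 0 0.
Proof.
have [h1 _ _] := bal.
have h : T *m 1%:M *m T^t* = 1%:M - c^t* *m c by rewrite mulmx1.
have := congr1 (fun Z => (b *m Z *m ((T ^+ e)^t* *m b^t*)) 0 0) (stein_partial_sum N h).
rewrite mulmx1 mulmxBr mulmxBl mulmx1 !mulmxA => e'.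
transitivity ((b *m (T ^+ e)^t* *m b^t* - b *m T ^+ N *m (T ^+ (e + N))^t* *m b^t*) 0 0); last first.
  by rewrite [LHS]mxE; congr (_ + _); rewrite [LHS]mxE.
rewrite exprD -mulmxE adjmxM !mulmxA -e' mulmx_sumr !mulmx_suml summxE; apply: eq_bigr => l _.
rewrite conj_impulse mulrC /impulse mx11M addnC exprD -mulmxE adjmxM.
by congr (fun_of_matrix _ 0 0); rewrite !mulmxA.
Qed.

Lemma sum_ord_cat (F : nat -> C) k l :
  \sum_(a < (k + l).+1) F a = \sum_(j < k) F j + \sum_(e < l.+1) F (k + e)%N.
Proof. by rewrite -addnS big_split_ord. Qed.

Lemma szego_partialE k N :
  szego_nl_partial y k N = szego_field T P b c k - szego_rest k N.
Proof.
rewrite /szego_nl_partial big_mkord.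
(* With [l] for [k2], the index [k1] is split at [k]. Below it the sum over [l] is a correlation of
   lag [k - j]. For [k1 = k + e] the third index is [m = l - e], and the triangle [e <= l < N] is
   summed over [l] first. *)
transitivity (\sum_(j < k) y j * (\sum_(l < N) (y l)^* * y (l + (k - j))%N) +
   \sum_(e < N) y (k + e)%N * \sum_(m < N - e) (y (m + e)%N)^* * y m).
  under eq_bigr => l _.
    rewrite (sum_ord_cat (fun a => y a * (y l)^* * y (k + l - a)%N)).
    over.
  rewrite big_split /=; congr (_ + _).
    rewrite exchange_big /=; apply: eq_bigr => j _; rewrite mulr_sumr; apply: eq_bigr => l _.
    by rewrite mulrA; congr (_ * y _); have := ltn_ord j; lia.
  transitivity (\sum_(0 <= l < N) \sum_(0 <= e < l.+1) y (k + e)%N * (y l)^* * y (l - e)%N).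
    rewrite big_mkord; apply: eq_bigr => l _; rewrite big_mkord; apply: eq_bigr => e _.
    by congr (_ * y _); lia.
  transitivity (\sum_(0 <= l < N) \sum_(0 <= e < N | (e <= l)%N) y (k + e)%N * (y l)^* * y (l - e)%N).
    by apply: eq_big_nat => l /andP[_ lN]; rewrite (big_nat_widen 0 l.+1 N).
  rewrite (exchange_big_dep_nat xpredT)//=.
  rewrite big_mkord; apply: eq_bigr => e _; rewrite mulr_sumr.
  transitivity (\sum_(e <= l < N) y (k + e)%N * (y l)^* * y (l - e)%N).
    by rewrite (big_nat_widenl e 0).
  rewrite -{1}[e : nat]add0n big_addn big_mkord; apply: eq_bigr => m _.
  by rewrite addnK mulrA.
have swap (z1 z2 z3 z4 : C) : z1 + z2 - (z3 + z4) = (z2 - z3) + (z1 - z4) by ring.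
rewrite /szego_field /szego_rest swap; congr (_ + _).
  rewrite -sumrB; apply: eq_bigr => j _.
  by rewrite impulse_correlation mulrBr ![y j * _]mulrC.
have [_ h2 _] := bal.
have h : T^t* *m P *m T^t*^t* = P - b^t* *m b by rewrite trmxCK.
transitivity (\sum_(e < N) y (k + e)%N * (b *m (T ^+ e)^t* *m b^t*) 0 0 -
   \sum_(e < N) y (k + e)%N * (b *m T ^+ (N - e) *m (T ^+ N)^t* *m b^t*) 0 0).
  rewrite -sumrB; apply: eq_bigr => e _; rewrite -mulrBr; congr (_ * _).
  by rewrite impulse_correlation_conj subnKC// ltnW.
rewrite opprD addrA; congr (_ - _).
(* Since [y_(k+e) = b T^e T^k c^*], the sum over [e] contains the telescoped series of the matrices
   [T^*^e b^* b T^e], whose limit is [P]. *)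
have := congr1 (fun Z => (b *m Z *m (T ^+ k *m c^t*)) 0 0) (stein_partial_sum N h).
rewrite mulmxBr mulmxBl -!adjmxX !trmxCK !mulmxA => e'.
transitivity ((b *m P *m T ^+ k *m c^t* - b *m (T ^+ N)^t* *m P *m T ^+ N *m T ^+ k *m c^t*) 0 0); last first.
  by rewrite [LHS]mxE; congr (_ + _); rewrite [LHS]mxE.
rewrite -e' mulmx_sumr !mulmx_suml summxE; apply: eq_bigr => e _.
rewrite -adjmxX trmxCK mulrC /impulse mx11M addnC exprD -mulmxE.
by congr (fun_of_matrix _ 0 0); rewrite !mulmxA.
Qed.

Hypothesis sT : stablemx_pow T.

Lemma szego_rest_decay k : geodecay (fun N => nc (szego_rest k N)).
Proof.
have nT0 N : 0 <= mxnc (T ^+ N) by exact: mxnc_ge0.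
have sT2 : geodecay (fun N => mxnc (T ^+ N) * mxnc (T ^+ N)) by exact: geodecayM.
have le3 (x : 'rV[C]_n.+1) (A B : 'M[C]_n.+1) (z : 'cV[C]_n.+1) :
    nc ((x *m A *m B *m z) 0 0) <= mxnc x * mxnc A * mxnc B * mxnc z.
  rewrite (le_trans (mxnc_entry _ _ _))// (le_trans (mxncM _ _))// ler_wpM2r ?mxnc_ge0//.
  rewrite (le_trans (mxncM _ _))// ler_wpM2r ?mxnc_ge0//; exact: mxncM.
have [Kt Kt0 hKt] := geodecay_bounded sT.
have yle l : nc (y l) <= mxnc b * Kt * mxnc c.
  rewrite (le_trans (mxnc_entry _ _ _))// (le_trans (mxncM _ _))// mxnc_adj ler_wpM2r ?mxnc_ge0//.
  by rewrite (le_trans (mxncM _ _))// ler_wpM2l ?mxnc_ge0.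
pose s1 := \sum_(j < k) mxnc (b *m T ^+ (k - j)) * mxnc b * nc (y j).
pose s2 := mxnc b * mxnc P * mxnc (T ^+ k *m c^t*).
pose s3 := mxnc b * Kt * mxnc c * (mxnc b * Kt * mxnc b).
have s10 : 0 <= s1 by apply: sumr_ge0 => j _; rewrite !mulr_ge0 ?mxnc_ge0 ?nc_ge0.
have s20 : 0 <= s2 by rewrite !mulr_ge0 ?mxnc_ge0.
have s30 : 0 <= s3 by rewrite !mulr_ge0 ?mxnc_ge0.
(* The last sum of the remainder has [N] terms, each bounded by a multiple of the norm of
   [T ^+ N]. *)
have g3 : geodecay (fun N => N.+1%:R * (s3 * mxnc (T ^+ N))).
  exact: geodecay_arith (geodecayZ s30 sT) _.
apply: geodecay_le (geodecayD (geodecayZ s10 sT2) (geodecayD (geodecayZ s20 sT2) g3)) => N.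
rewrite (le_trans (ncD _ _))// lerD//; last rewrite (le_trans (ncD _ _))// lerD//.
- rewrite (le_trans (nc_sum _ _ _))// mulr_suml; apply: ler_sum => j _.
  rewrite ncM mulrAC ler_wpM2r ?nc_ge0// (le_trans (le3 _ _ _ _))// !mxnc_adj.
  by rewrite le_eqVlt; apply/orP; left; apply/eqP; ring.
- have -> : b *m (T ^+ N)^t* *m P *m T ^+ N *m T ^+ k *m c^t* =
            b *m (T ^+ N)^t* *m P *m T ^+ N *m (T ^+ k *m c^t*) by rewrite !mulmxA.
  rewrite (le_trans (mxnc_entry _ _ _))// (le_trans (mxncM _ _))//.
  rewrite (_ : s2 * _ = mxnc b * mxnc ((T ^+ N)^t*) * mxnc P * mxnc (T ^+ N) * mxnc (T ^+ k *m c^t*)).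
    rewrite ler_wpM2r ?mxnc_ge0// (le_trans (mxncM _ _))// ler_wpM2r ?mxnc_ge0//.
    by rewrite (le_trans (mxncM _ _))// ler_wpM2r ?mxnc_ge0// mxncM.
  by rewrite mxnc_adj /s2; ring.
- rewrite (le_trans (nc_sum _ _ _))//.
  apply: (@le_trans _ _ (\sum_(e < N) s3 * mxnc (T ^+ N))).
    apply: ler_sum => e _; rewrite ncM /s3 -mulrA ler_pM ?nc_ge0// (le_trans (le3 _ _ _ _))//.
    rewrite !mxnc_adj [leRHS]mulrAC ler_wpM2r ?mxnc_ge0// ler_wpM2r ?mxnc_ge0//.
    by rewrite ler_wpM2l ?mxnc_ge0.
  rewrite /= sumr_const card_ord -[leLHS]mulr_natl ler_wpM2r ?mulr_ge0 ?mxnc_ge0//.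
  by rewrite ler_nat.
Qed.

End TorusFlow.

Section SzegoLimit.
Local Open Scope classical_set_scope.
Variable R : realType.
Local Notation C := R[i].

Lemma szego_nl_cvg (u : nat -> C) k z (r : nat -> R) :
  geodecay r -> (forall N, nc (szego_nl_partial u k N - z) <= r N) ->
  ((fun N => complex.Re (szego_nl_partial u k N)) @ \oo --> complex.Re z) /\
  ((fun N => complex.Im (szego_nl_partial u k N)) @ \oo --> complex.Im z).
Proof.
move=> gr h; split; apply/cvgrPdist_lt => e e0; have [N0 hN] := geodecay_cvg0 gr e0;
  exists N0 => // N /= /hN; apply: le_lt_trans; apply: le_trans (h N).
- apply: le_trans (nc_Re _); rewrite distrC.
  by case: (szego_nl_partial _ _ _) z {h} => ? ? [].
- apply: le_trans (nc_Im _); rewrite distrC.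
  by case: (szego_nl_partial _ _ _) z {h} => ? ? [].
Qed.

Lemma szego_nl_eq (u : nat -> C) k z (r : nat -> R) :
  geodecay r -> (forall N, nc (szego_nl_partial u k N - z) <= r N) -> szego_nl u k = z.
Proof.
move=> gr h; have [h1 h2] := szego_nl_cvg gr h.
by rewrite /szego_nl (cvg_lim _ h1)// (cvg_lim _ h2)//; case: z {h h1 h2}.
Qed.

Lemma szego_nl_impulse n (T P : 'M[C]_n.+1) (b c : 'rV[C]_n.+1) k :
  balanced T P b c -> stablemx_pow T ->
  szego_nl (impulse T b c) k = szego_field T P b c k.
Proof.
move=> bal sT; apply: (szego_nl_eq (szego_rest_decay P b c sT k)) => N.
by rewrite (szego_partialE bal) addrAC subrr sub0r ncN.
Qed.

End SzegoLimit.

Section RotationFlow.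
Local Open Scope classical_set_scope.
Variables (R : realType) (n : nat).
Local Notation C := R[i].
Variables (T P : 'M[C]_n.+1) (b c : 'rV[C]_n.+1) (U V : R -> 'M[C]_n.+1).
Hypothesis UU : forall t, U t *m (U t)^t* = 1%:M.
Hypothesis PU : forall t, P *m U t = U t *m P.
Hypothesis dU : forall t, mxderiv U t (- 'i *: (U t *m P)).
Hypothesis dV : forall t, mxderiv V t ('i *: (V t *m (P - b^t* *m b))).

Lemma mxderiv_flow_b t : mxderiv (fun s => b *m U s) t (- 'i *: (b *m U t *m P)).
Proof.
have := mxderivM (mxderiv_cst b t) (dU t).
by rewrite mul0mx add0r -scalemxAr mulmxA.
Qed.

(** The two terms in [P] cancel because [U] commutes with [P], and [U U^* = 1] turns the remaining
    [b^*] into [U (b U)^*]. *)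
Lemma mxderiv_flow_T t : mxderiv (fun s => T *m V s *m U s) t
  (- 'i *: (T *m V t *m U t *m (b *m U t)^t* *m (b *m U t))).
Proof.
have := mxderivM (mxderivM (mxderiv_cst T t) (dV t)) (dU t).
rewrite mul0mx add0r; congr mxderiv.
rewrite -scalemxAr -scalemxAl -scalemxAr scaleNr -scalerBr scaleNr -scalerN; congr (_ *: _).
have -> : T *m (V t *m (P - b^t* *m b)) *m U t =
    T *m V t *m (U t *m P) - T *m V t *m (b^t* *m (b *m U t)).
  by rewrite (mulmxA T) -(mulmxA (T *m V t)) mulmxBl mulmxBr -PU -(mulmxA (b^t*)).
rewrite addrAC subrr sub0r; congr (- _); rewrite adjmxM -!mulmxA; congr (_ *m (_ *m _)).
by rewrite (mulmxA (U t)) UU mul1mx.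
Qed.

Lemma mxderivX (F : R -> 'M[C]_n.+1) (w : 'rV[C]_n.+1) t k :
  mxderiv F t (- 'i *: (F t *m w^t* *m w)) ->
  mxderiv (fun s => F s ^+ k) t
    (- 'i *: \sum_(j < k) F t ^+ (k - j) *m w^t* *m w *m F t ^+ j).
Proof.
move=> dF; elim: k => [|k IH].
  rewrite big_ord0 scaler0; have := mxderiv_cst (1 : 'M[C]_n.+1) t.
  by congr mxderiv; apply/funext => s; rewrite expr0.
have := mxderivM IH dF.
rewrite (_ : (fun s => _) = (fun s => F s ^+ k.+1)); last by apply/funext => s; rewrite exprSr.
congr mxderiv; rewrite -scalemxAl -scalemxAr -scalerDr; congr (_ *: _).
rewrite big_ord_recl addrC subn0 expr0 mulmx1 (exprSr _ k) -mulmxE; congr (_ + _).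
  by rewrite !mulmxA.
rewrite mulmx_suml; apply: eq_bigr => j _.
by rewrite lift0 subSS (exprSr _ j) -mulmxE !mulmxA.
Qed.

Lemma rotation_ode t k :
  cderiv (fun s => impulse (T *m V s *m U s) (b *m U s) c k) t
    (- 'i * szego_field (T *m V t *m U t) P (b *m U t) c k).
Proof.
have := mxderivM (mxderivM (mxderiv_flow_b t) (mxderivX k (mxderiv_flow_T t))) (mxderiv_cst (c^t*) t).
rewrite mulmx0 addr0 => /(_ 0 0); congr cderiv.
move: (T *m V t *m U t) (b *m U t) => T' b'.
rewrite -scalemxAl -scalemxAr -scalerDr -scalemxAl mxE; congr (_ * _).
rewrite mulmxDl mxE; congr (_ + _).
rewrite mulmx_sumr mulmx_suml summxE; apply: eq_bigr => j _.
rewrite /impulse mx11M.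
by congr (fun_of_matrix _ 0 0); rewrite !mulmxA.
Qed.

End RotationFlow.

Section TorusODE.
Local Open Scope classical_set_scope.
Variables (R : realType) (n : nat).
Local Notation C := R[i].
Variables (T P : 'M[C]_n.+1) (b c : 'rV[C]_n.+1) (S1 S2 : 'M[C]_n.+1) (p q : 'rV[C]_n.+1).
Hypothesis bal : balanced T P b c.
Hypothesis S1u : S1 \is unitarymx.
Hypothesis S2u : S2 \is unitarymx.
Hypothesis PE : P = S1^t* *m diag_mx p *m S1.
Hypothesis QE : P - b^t* *m b = S2^t* *m diag_mx q *m S2.

Local Notation om := (frequencies p q).

Lemma mxderiv_rotU t : mxderiv (fun s => rotU S1 p (s *: om)) t
  (- 'i *: (rotU S1 p (t *: om) *m P)).
Proof.
have Ph : P^t* = P by case: bal => _ _ [].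
have preal := spectral_diag_real S1u PE Ph.
pose a j := - complex.Re (p 0 j).
have aE j : (a j)%:C%C = -1 * p 0 j.
  by rewrite mulN1r rmorphN /=; congr (- _); apply/RRe_real/CrealP.
rewrite -mulrN1; apply: (mxderiv_spectral t S1u PE aE) => s.
rewrite /rotU /spectral_fun; congr (_ *m diag_mx _ *m _); apply/rowP => j.
by rewrite mxE [RHS]mxE [(s *: om) 0 _]mxE row_mxEl mxE eig_indexK mulrN.
Qed.

Lemma mxderiv_rotV t : mxderiv (fun s => rotV S2 q (s *: om)) t
  ('i *: (rotV S2 q (t *: om) *m (P - b^t* *m b))).
Proof.
have Ph : P^t* = P by case: bal => _ _ [].
have Qh : (P - b^t* *m b)^t* = P - b^t* *m b by rewrite adjmxB adjmxM trmxCK Ph.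
have qreal := spectral_diag_real S2u QE Qh.
pose a j := complex.Re (q 0 j).
have aE j : (a j)%:C%C = 1 * q 0 j.
  by rewrite mul1r; apply/RRe_real/CrealP.
rewrite -['i]mulr1; apply: (mxderiv_spectral t S2u QE aE) => s.
rewrite /rotV /spectral_fun; congr (_ *m diag_mx _ *m _); apply/rowP => j.
by rewrite mxE [RHS]mxE [(s *: om) 0 _]mxE row_mxEr mxE eig_indexK.
Qed.

Lemma torus_ode t k : cderiv (fun s => torus_map T b c S1 S2 p q (s *: om) k) t
  (- 'i * szego_field (torus_T T S1 S2 p q (t *: om)) P (torus_b b S1 p (t *: om)) c k).
Proof.
have UU s := let: And3 h _ _ := rotU_fun S1u PE (s *: om) in h.
have PU s := let: And3 _ h _ := rotU_fun S1u PE (s *: om) in h.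
exact: (rotation_ode T c UU PU mxderiv_rotU mxderiv_rotV t k).
Qed.

End TorusODE.

(** * Locally uniform decay *)

Section MatrixLimits.
Local Open Scope classical_set_scope.
Variables (R : realType) (X : topologicalType) (x0 : X).
Local Notation C := R[i].

Definition tends0 (a : X -> R) := a x @[x --> x0] --> (0 : R).

Lemma tends0_near a e : tends0 a -> 0 < e -> \forall x \near x0, a x < e.
Proof.
move=> /cvgrPdist_lt h e0; have := h e e0; apply: filterS => x.
by rewrite sub0r normrN; apply: le_lt_trans; exact: ler_norm.
Qed.

Lemma tends0_le a b : (\forall x \near x0, 0 <= a x <= b x) -> tends0 b -> tends0 a.
Proof.
by move=> h hb; apply: (@squeeze_cvgr _ _ _ _ (fun=> 0) b) => //; exact: cvg_cst.
Qed.

Lemma tends0D a b : tends0 a -> tends0 b -> tends0 (fun x => a x + b x).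
Proof. by move=> ha hb; rewrite /tends0 -[0 in X in _ --> X]addr0; exact: cvgD. Qed.

Lemma tends0M a b : tends0 a -> tends0 b -> tends0 (fun x => a x * b x).
Proof. by move=> ha hb; rewrite /tends0 -[0 in X in _ --> X](mulr0 0); exact: cvgM. Qed.

Lemma tends0Z c a : tends0 a -> tends0 (fun x => c * a x).
Proof. by move=> ha; rewrite /tends0 -[0 in X in _ --> X](mulr0 c); apply: cvgM => //; exact: cvg_cst. Qed.

Lemma tends0_sum I (r : seq I) (F : I -> X -> R) :
  (forall i, tends0 (F i)) -> tends0 (fun x => \sum_(i <- r) F i x).
Proof.
move=> h; elim: r => [|i r IH].
  by rewrite (_ : (fun x => _) = fun=> 0); [exact: cvg_cst|apply/funext => x; rewrite big_nil].
rewrite (_ : (fun x => _) = (fun x => F i x + \sum_(i <- r) F i x)); first exact: tends0D.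
by apply/funext => x; rewrite big_cons.
Qed.

Lemma tends0_dist (g : X -> R) : {for x0, continuous g} -> tends0 (fun x => `|g x - g x0|).
Proof.
move=> /cvgrPdist_lt h; apply/cvgrPdist_lt => e e0; have := h e e0; apply: filterS => x.
by rewrite sub0r normrN normr_id distrC.
Qed.

Lemma tends0_complex (f : X -> C) : {for x0, continuous (fun x => complex.Re (f x))} ->
  {for x0, continuous (fun x => complex.Im (f x))} -> tends0 (fun x => nc (f x - f x0)).
Proof.
move=> c1 c2; apply: tends0_le (tends0D (tends0_dist c1) (tends0_dist c2)); near=> s.
rewrite nc_ge0 /= (le_trans (nc_le_ReIm _))//.
by case: (f s) (f x0) => ? ? [].
Unshelve. all: by end_near.
Qed.

Definition mxtends m n (F : X -> 'M[C]_(m, n)) (F0 : 'M[C]_(m, n)) :=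
  tends0 (fun x => mxnc (F x - F0)).

Lemma mxncD m n (A B : 'M[C]_(m, n)) : mxnc (A + B) <= mxnc A + mxnc B.
Proof.
rewrite /mxnc -big_split; apply: ler_sum => i _; rewrite -big_split; apply: ler_sum => j _.
by rewrite mxE ncD.
Qed.

Lemma mxncN m n (A : 'M[C]_(m, n)) : mxnc (- A) = mxnc A.
Proof. by apply: eq_bigr => i _; apply: eq_bigr => j _; rewrite mxE ncN. Qed.

Lemma mxtendsM m n p (F : X -> 'M[C]_(m, n)) F0 (G : X -> 'M[C]_(n, p)) G0 :
  mxtends F F0 -> mxtends G G0 -> mxtends (fun x => F x *m G x) (F0 *m G0).
Proof.
move=> hF hG.
apply: tends0_le (tends0D (tends0M hF hG) (tends0D (tends0Z (mxnc G0) hF) (tends0Z (mxnc F0) hG))).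
near=> x; rewrite mxnc_ge0 /=.
have -> : F x *m G x - F0 *m G0 =
    (F x - F0) *m (G x - G0) + ((F x - F0) *m G0 + F0 *m (G x - G0)).
  by rewrite addrA -mulmxDr subrK mulmxBl mulmxBr addrA subrK.
rewrite (le_trans (mxncD _ _))// lerD ?mxncM// (le_trans (mxncD _ _))// lerD ?mxncM//.
by rewrite mulrC mxncM.
Unshelve. all: by end_near.
Qed.

Lemma mxtendsX n (F : X -> 'M[C]_n.+1) F0 k : mxtends F F0 -> mxtends (fun x => F x ^+ k) (F0 ^+ k).
Proof.
move=> h; elim: k => [|k IH].
  rewrite /mxtends (_ : (fun x => _) = fun=> 0); first exact: cvg_cst.
  by apply/funext => x; rewrite !expr0 subrr mxnc0.
rewrite (_ : (fun x => F x ^+ k.+1) = (fun x => F x *m F x ^+ k)); last first.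
  by apply/funext => x; rewrite exprS.
by rewrite exprS; exact: mxtendsM.
Qed.

(* [F0 (A - A0) = (G - F A0) - (F - F0)(A - A0)] *)
Lemma mxtends_solve n (F G A : X -> 'M[C]_n.+1) F0 G0 A0 : F0 \in unitmx ->
  (forall x, F x *m A x = G x) -> F0 *m A0 = G0 ->
  mxtends F F0 -> mxtends G G0 -> mxtends A A0.
Proof.
move=> Fu FA FA0 hF hG.
pose s := mxnc (invmx F0).
have s0 : 0 <= s := mxnc_ge0 _.
have hE : mxtends (fun x => G x - F x *m A0) 0.
  apply: tends0_le (tends0D hG (tends0Z (mxnc A0) hF)).
  near=> x; rewrite mxnc_ge0 /= subr0.
  have -> : G x - F x *m A0 = (G x - G0) - (F x - F0) *m A0.
    by rewrite mulmxBl FA0 opprB addrA subrK.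
  by rewrite (le_trans (mxncD _ _))// lerD2l mxncN mulrC mxncM.
apply: tends0_le (tends0Z (2 * s) hE).
(* Within this radius [s * mxnc (F x - F0)] is at most 1/2, so that the term in [A x - A0] on the
   right is absorbed. *)
have n1 : \forall x \near x0, mxnc (F x - F0) < (2 * (s + 1))^-1.
  by apply: tends0_near hF _; rewrite invr_gt0 mulr_gt0// ltr_wpDl.
near=> x; rewrite mxnc_ge0 subr0 /=.
have n1x : mxnc (F x - F0) < (2 * (s + 1))^-1 by near: x.
have E : A x - A0 = invmx F0 *m ((G x - F x *m A0) - (F x - F0) *m (A x - A0)).
  rewrite -[LHS](mulKmx Fu); congr (_ *m _).
  by rewrite -FA -mulmxBr -mulmxBl subKr.
have h : mxnc (A x - A0) <= s * (mxnc (G x - F x *m A0) + mxnc (F x - F0) * mxnc (A x - A0)).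
  rewrite {1}E (le_trans (mxncM _ _))// ler_wpM2l// (le_trans (mxncD _ _))// mxncN lerD2l.
  exact: mxncM.
have h2 : s * (mxnc (F x - F0) * mxnc (A x - A0)) <= 2^-1 * mxnc (A x - A0).
  rewrite mulrA ler_wpM2r ?mxnc_ge0// (le_trans (ler_wpM2l s0 (ltW n1x)))//.
  rewrite invfM mulrCA ler_piMr// ler_pdivrMr ?ltr_wpDl// mul1r lerDl//.
rewrite mulrDr in h; lra.
Unshelve. all: by end_near.
Qed.

End MatrixLimits.

Section LocalDecay.
Local Open Scope classical_set_scope.
Variable R : realType.
Local Notation C := R[i].

(** Bernoulli's inequality gives an explicit rate in place of the m-th root of 1/2. *)
Lemma bernoulli_half m : (0 < m)%N ->
  2^-1 <= (1 - (2 * m%:R)^-1 : R) ^+ m.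
Proof.
move=> m0; set x := (2 * m%:R)^-1.
have x0 : 0 <= x by rewrite invr_ge0 mulr_ge0.
have x1 : x <= 1.
  by rewrite /x -natrM invf_le1 ?ltr0n ?ler1n ?muln_gt0.
have h k : 1 - k%:R * x <= (1 - x) ^+ k.
  elim: k => [|k IH]; first by rewrite mul0r subr0 expr0.
  rewrite exprS; apply: le_trans (ler_wpM2l _ IH); last by rewrite subr_ge0.
  have : 0 <= k%:R * x * x by rewrite !mulr_ge0.
  by rewrite -natr1; nra.
apply: le_trans (h m); rewrite /x invfM mulrCA mulfV ?mulr1; first lra.
by rewrite pnatr_eq0 -lt0n.
Qed.

(** [y x k] is an entry of [H x 0 * A x ^+ k], and finitely many coordinates determine [A x], which
    therefore varies continuously. A power [m] with [A x0 ^+ m] small keeps [A x ^+ m] below 1/2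
    nearby, and dividing [k] by [m] gives a common rate. *)
Lemma local_geodecay n d (X : topologicalType) (y : X -> nat -> C) (x0 : X) :
  uphalf d = n.+1 -> (forall x, inVd d (y x)) ->
  (forall k, tends0 x0 (fun x => nc (y x k - y x0 k))) ->
  exists K q : R, [/\ 0 <= K, 0 < q, q < 1 &
    \forall x \near x0, forall k, nc (y x k) <= K * q ^+ k].
Proof.
move=> dn hy cy.
pose H x k := hankel n.+1 (y x) k.
pose A x := invmx (H x 0%N) *m H x 1%N.
have Hu x : H x 0%N \in unitmx by have [a [b /Vd_hankel]] := hy x; rewrite dn.
have HA x k : H x 0%N *m A x ^+ k = H x k.
  have [a [b hx]] := hy x; have [_ sb _] := Vd_size hx.
  have b0 : b`_0 = 1 by case: hx.
  have hb l : (n.+1 <= l)%N -> pconv b (y x) l = 0.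
    by rewrite -dn; exact: Vd_recurrence hx.
  rewrite dn in sb.
  elim: k => [|k IH]; first by rewrite expr0 mulmx1.
  by rewrite exprSr -mulmxE mulmxA IH; exact: hankel_shift (Hu x) sb b0 hb k.
have cH k : mxtends x0 (H ^~ k) (H x0 k).
  rewrite /mxtends /mxnc; apply: tends0_sum => i; apply: tends0_sum => j.
  rewrite (_ : (fun x => _) = (fun x => nc (y x (i + j + k)%N - y x0 (i + j + k)%N))).
    exact: cy.
  by apply/funext => x; rewrite !mxE.
have cA : mxtends x0 A (A x0).
  apply: (mxtends_solve (Hu x0) _ _ (cH 0%N) (cH 1%N)) => [x|]; by rewrite mulKVmx.
have gA : geodecay (fun k => mxnc (A x0 ^+ k)).
  apply: geodecay_le (geodecayZ (mxnc_ge0 (invmx (H x0 0%N))) (geodecay_hankel n (Vd_geodecay (hy x0)))) => k.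
  by rewrite -/(H x0 k) -(HA x0 k); apply: le_trans (mxncM _ _); rewrite mulKmx.
(* Half of the intended bound 1/2 on [A x ^+ m]; the other half is left for the variation of [x]. *)
have [|m0 hm0] := geodecay_cvg0 gA (_ : 0 < 4^-1); first by rewrite invr_gt0.
pose m := m0.+1.
have hm : mxnc (A x0 ^+ m) < 4^-1 by apply: hm0; exact: leqnSn.
pose c1 := mxnc (A x0) + 1.
have c11 : 1 <= c1 by rewrite lerDr mxnc_ge0.
have [Bd BdE] : exists Bd, Bd = mxnc (1 : 'M[C]_n.+1) * c1 ^+ m by eexists.
have Bd0 : 0 <= Bd by rewrite BdE mulr_ge0 ?mxnc_ge0// exprn_ge0// (le_trans ler01).
pose rho : R := 1 - (2 * m%:R)^-1.
have rhom : 2^-1 <= rho ^+ m by exact: bernoulli_half.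
have mp : 0 < (2 * m%:R)^-1 :> R by rewrite invr_gt0 mulr_gt0.
have rho1 : rho < 1 by rewrite /rho ltrBlDr ltrDl.
have rho0 : 0 < rho.
  by rewrite subr_gt0 -natrM invf_lt1 ?ltr0n ?ltr1n// /m; lia.
(* [Bd] bounds the powers of [A x] up to [m], and 2 bounds the inverse of [rho ^+ (k %% m)]. *)
exists ((mxnc (H x0 0%N) + 1) * Bd * 2), rho; split=> //.
  by apply: mulr_ge0 => //; apply: mulr_ge0 => //; rewrite addr_ge0 ?mxnc_ge0.
have n1 : \forall x \near x0, mxnc (A x ^+ m - A x0 ^+ m) < 4^-1.
  by apply: tends0_near; [exact: mxtendsX|rewrite invr_gt0].
have n2 : \forall x \near x0, mxnc (A x - A x0) < 1 by exact: tends0_near.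
have n3 : \forall x \near x0, mxnc (H x 0%N - H x0 0%N) < 1 by exact: tends0_near (cH 0%N) _.
near=> x => k.
have n1x : mxnc (A x ^+ m - A x0 ^+ m) < 4^-1 by near: x.
have n2x : mxnc (A x - A x0) < 1 by near: x.
have n3x : mxnc (H x 0%N - H x0 0%N) < 1 by near: x.
have Am : mxnc (A x ^+ m) <= 2^-1.
  rewrite -(subrK (A x0 ^+ m) (A x ^+ m)) (le_trans (mxncD _ _))//.
  by rewrite (le_trans (lerD (ltW n1x) (ltW hm)))//; lra.
have A1 : mxnc (A x) <= c1.
  by rewrite -(subrK (A x0) (A x)) (le_trans (mxncD _ _))// addrC lerD2l ltW.
have H1 : mxnc (H x 0%N) <= mxnc (H x0 0%N) + 1.
  by rewrite -(subrK (H x0 0%N) (H x 0%N)) (le_trans (mxncD _ _))// addrC lerD2l ltW.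
have Ar r : (r <= m)%N -> mxnc (A x ^+ r) <= Bd.
  move=> rm; apply: (@le_trans _ _ (mxnc (1 : 'M[C]_n.+1) * c1 ^+ r)); last first.
    by rewrite BdE ler_wpM2l ?mxnc_ge0// ler_weXn2l.
  elim: {rm} r => [|r IH]; first by rewrite !expr0 mulr1.
  rewrite exprSr (le_trans (mxncM _ _))// exprSr mulrA.
  by rewrite ler_pM ?mxnc_ge0.
have Aq j r : (r <= m)%N -> mxnc (A x ^+ (j * m + r)) <= 2^-1 ^+ j * Bd.
  move=> rm; elim: j => [|j IH]; first by rewrite mul0n add0n expr0 mul1r Ar.
  rewrite mulSn -addnA exprD (le_trans (mxncM _ _))// exprS -mulrA.
  by rewrite ler_pM ?mxnc_ge0.
have -> : y x k = (H x k) 0 0 by rewrite mxE.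
rewrite -(HA x k) (le_trans (mxnc_entry _ _ _))// (le_trans (mxncM _ _))//.
rewrite -!mulrA ler_pM ?mxnc_ge0//.
have mk : (k %% m <= m)%N by rewrite ltnW// ltn_mod.
rewrite {1}(divn_eq k m) (le_trans (Aq _ _ mk))// [leLHS]mulrC ler_wpM2l//.
rewrite {2}(divn_eq k m) exprD mulnC exprM.
have e1 : 2^-1 <= rho ^+ (k %% m) by rewrite (le_trans rhom)// ler_wiXn2l// ltW.
have e2 : 2^-1 ^+ (k %/ m) <= (rho ^+ m) ^+ (k %/ m) :> R by rewrite lerXn2r// nnegrE ?exprn_ge0// ltW.
have e3 : 0 <= (rho ^+ m) ^+ (k %/ m) by rewrite !exprn_ge0// ltW.
have e4 : 1 <= 2 * rho ^+ (k %% m) by rewrite -ler_pdivrMl// mulr1.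
by rewrite (le_trans e2)// mulrCA ler_peMr.
Unshelve. all: by end_near.
Qed.

End LocalDecay.

(** * Uniqueness *)

Section Lipschitz.
Local Open Scope classical_set_scope.
Variable R : realType.
Local Notation C := R[i].
Implicit Types (a b : nat -> C).

Lemma nc_trilinear_diff (x1 x2 x3 y1 y2 y3 : C) (D m1 m2 m3 : R) :
  nc (x1 - y1) <= D -> nc (x2 - y2) <= D -> nc (x3 - y3) <= D ->
  nc x2 <= m2 -> nc x3 <= m3 -> nc y1 <= m1 -> nc y2 <= m2 ->
  nc (x1 * x2 * x3 - y1 * y2 * y3) <= D * (m2 * m3 + m1 * m3 + m1 * m2).
Proof.
move=> h1 h2 h3 a2 a3 b1 b2.
have -> : x1 * x2 * x3 - y1 * y2 * y3 =
  (x1 - y1) * (x2 * x3) + (y1 * (x2 - y2) * x3 + y1 * y2 * (x3 - y3)) by ring.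
rewrite !(mulrDr D) -[leRHS]addrA; apply: le_trans (ncD _ _) _; apply: lerD.
  by rewrite !ncM ler_pM ?mulr_ge0 ?nc_ge0// ler_pM ?nc_ge0.
apply: le_trans (ncD _ _) _; apply: lerD; rewrite !ncM.
  by rewrite mulrA (mulrC D) ler_pM ?mulr_ge0 ?nc_ge0// ler_pM ?nc_ge0.
by rewrite (mulrC D) ler_pM ?mulr_ge0 ?nc_ge0// ler_pM ?nc_ge0.
Qed.

(** With [q = p * p], one factor gives decay in the outer index [l] and the other controls the inner
    sum over [j]. One of the three products has the constant inner weight [p ^+ (k + l)], whence
    [arith_geometric_le]; three inner sums and one outer sum produce [3 * c ^+ 2]. *)
Lemma szego_partial_lipschitz (K q : R) : 0 <= K -> 0 < q -> q < 1 ->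
  exists2 L : R, 0 <= L & forall a b D, 0 <= D ->
    (forall k, nc (a k) <= K * q ^+ k) -> (forall k, nc (b k) <= K * q ^+ k) ->
    (forall k, nc (a k - b k) <= D) ->
    forall k N, nc (szego_nl_partial a k N - szego_nl_partial b k N) <= L * D.
Proof.
move=> K0 q0 q1; pose p := Num.sqrt q.
have p0 : 0 < p by rewrite sqrtr_gt0.
have p1 : p < 1 by rewrite -sqrtr1 ltr_sqrt.
have pE k : q ^+ k = p ^+ k * p ^+ k.
  by rewrite -exprMn; congr (_ ^+ _); rewrite -expr2 sqr_sqrtr// ltW.
have px k : 0 <= p ^+ k by rewrite exprn_ge0// ltW.
have px1 k : p ^+ k <= 1 by rewrite exprn_ile1// ltW.
pose c := (1 - p)^-1.
have c0 : 0 <= c by rewrite invr_ge0 subr_ge0 ltW.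
exists (K ^+ 2 * (3 * c ^+ 2)); first by rewrite mulr_ge0 ?exprn_ge0// mulr_ge0 ?exprn_ge0.
move=> a b D D0 ha hb hab k N.
have mono m n : (m <= n)%N -> p ^+ n <= p ^+ m by move=> mn; rewrite ler_wiXn2l// ltW.
have main l : nc (\sum_(j < (k + l).+1) a j * (a l)^* * a (k + l - j)%N -
    \sum_(j < (k + l).+1) b j * (b l)^* * b (k + l - j)%N) <= D * K ^+ 2 * (p ^+ l * (3 * c)).
  rewrite -sumrB (le_trans (nc_sum _ _ _))//.
  apply: (@le_trans _ _ (\sum_(j < (k + l).+1) D * K ^+ 2 * (p ^+ l * (p ^+ (k + l - j) + p ^+ (k + l) + p ^+ j)))).
    apply: ler_sum => j _.
    have jn : (j <= k + l)%N by rewrite -ltnS.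
    have cl : nc ((a l)^* - (b l)^*) <= D by rewrite -rmorphB nc_conj.
    have al : nc (a l)^* <= K * q ^+ l by rewrite nc_conj.
    have bl : nc (b l)^* <= K * q ^+ l by rewrite nc_conj.
    apply: le_trans (nc_trilinear_diff (hab j) cl (hab _) al (ha _) (hb j) bl) _.
    rewrite -[leRHS]mulrA ler_wpM2l// [K ^+ 2]expr2.
    have -> : K * q ^+ l * (K * q ^+ (k + l - j)) + K * q ^+ j * (K * q ^+ (k + l - j)) + K * q ^+ j * (K * q ^+ l) =
       K * K * (q ^+ l * q ^+ (k + l - j) + q ^+ (j + (k + l - j)) + q ^+ j * q ^+ l) by rewrite exprD; ring.
    rewrite ler_wpM2l ?mulr_ge0// subnKC// !mulrDr !pE; apply: lerD; first apply: lerD.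
    - rewrite ler_pM ?mulr_ge0//; by rewrite ler_piMl.
    - by rewrite ler_wpM2r// mono// leq_addl.
    - by rewrite mulrC ler_pM ?mulr_ge0//; rewrite ler_piMl.
  rewrite -mulr_sumr ler_wpM2l ?mulr_ge0 ?exprn_ge0// -mulr_sumr ler_wpM2l//.
  rewrite !big_split /= (_ : 3 * c = c + c + c); last by ring.
  rewrite !lerD//.
  - rewrite (reindex_inj rev_ord_inj) /= (le_trans _ (geometric_sum_le (k + l).+1 (ltW p0) p1))//.
    by apply: ler_sum => j _; rewrite subSS subKn// -ltnS.
  - rewrite sumr_const card_ord -mulr_natl; exact: arith_geometric_le (ltW p0) p1.
  - exact: geometric_sum_le (ltW p0) p1.
rewrite /szego_nl_partial !big_mkord -sumrB (le_trans (nc_sum _ _ _))//.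
rewrite (le_trans (ler_sum _ (fun l _ => main (nat_of_ord l))))//.
rewrite -mulr_sumr -mulr_suml.
have -> : K ^+ 2 * (3 * c ^+ 2) * D = D * K ^+ 2 * (c * (3 * c)) by ring.
rewrite ler_wpM2l ?mulr_ge0 ?exprn_ge0// ler_wpM2r ?mulr_ge0//.
exact: geometric_sum_le (ltW p0) p1.
Qed.

(** [limn] denotes a value even without convergence; a balanced realization of [a] supplies the
    convergence, with a rate. *)
Lemma Vd_szego_cvg d n a k : uphalf d = n.+1 -> inVd d a ->
  geodecay (fun N => nc (szego_nl_partial a k N - szego_nl a k)).
Proof.
move=> dn ha; have [A [B h]] := ha; have [_ sB _] := Vd_size h.
have Hu := Vd_hankel h; have B0 : B`_0 = 1 by case: h.
have hB l : (n.+1 <= l)%N -> pconv B a l = 0 by rewrite -dn; exact: Vd_recurrence h.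
rewrite dn in sB Hu.
have [T [P [b [c [bal sT _ E]]]]] := balanced_realization Hu sB B0 hB (Vd_geodecay ha).
have -> : a = impulse T b c by apply/funext.
rewrite (szego_nl_impulse k bal sT).
apply: geodecay_le (szego_rest_decay P b c sT k) => N.
by rewrite (szego_partialE bal) addrAC subrr sub0r ncN.
Qed.

Lemma szego_lipschitz d n (K q : R) : uphalf d = n.+1 -> 0 <= K -> 0 < q -> q < 1 ->
  exists2 L : R, 0 <= L & forall a b D, 0 <= D -> inVd d a -> inVd d b ->
    (forall k, nc (a k) <= K * q ^+ k) -> (forall k, nc (b k) <= K * q ^+ k) ->
    (forall k, nc (a k - b k) <= D) ->
    forall k, nc (szego_nl a k - szego_nl b k) <= L * D.
Proof.
move=> dn K0 q0 q1; have [L L0 hL] := szego_partial_lipschitz K0 q0 q1.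
exists L => // a b D D0 va vb ha hb hab k; rewrite -subr_le0.
apply: geodecay_le0 (geodecayD (Vd_szego_cvg k dn va) (Vd_szego_cvg k dn vb)) _ => N.
rewrite lerBlDr.
have -> : szego_nl a k - szego_nl b k =
  - (szego_nl_partial a k N - szego_nl a k) + (szego_nl_partial b k N - szego_nl b k)
  + (szego_nl_partial a k N - szego_nl_partial b k N) by ring.
rewrite (le_trans (ncD _ _))// lerD ?hL// (le_trans (ncD _ _))// ncN//.
Qed.

End Lipschitz.

Section Uniqueness.
Local Open Scope classical_set_scope.
Variable R : realType.
Local Notation C := R[i].

Lemma mvt_bound (f df : R -> R) (t0 t eta B : R) : (forall s, is_derive s (1 : R) f (df s)) ->
  (forall s, `|s - t0| < eta -> `|df s| <= B) -> `|t - t0| < eta ->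
  `|f t - f t0| <= B * `|t - t0|.
Proof.
move=> Df hB ht.
have fc : continuous f.
  by move=> s; apply/differentiable_continuous/derivable1_diffP; have [] := Df s.
have [t0t|tt0] := leP t0 t.
- have [c] := MVT_segment t0t (fun x _ => Df x) (continuous_subspaceT fc).
  rewrite in_itv /= => /andP[c1 c2] ->; rewrite normrM ler_wpM2r// hB//.
  by rewrite ger0_norm ?subr_ge0// (le_lt_trans _ ht)// ger0_norm ?subr_ge0// lerD2r.
- have [c] := MVT_segment (ltW tt0) (fun x _ => Df x) (continuous_subspaceT fc).
  rewrite in_itv /= => /andP[c1 c2] e; rewrite distrC e (distrC t) normrM ler_wpM2r// hB//.
  rewrite distrC ger0_norm ?subr_ge0// (le_lt_trans _ ht)// distrC ger0_norm.
    by rewrite lerD2l lerN2.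
  by rewrite subr_ge0 ltW.
Qed.

Lemma cderiv_tends0 (f : R -> C) t a : cderiv f t a -> tends0 t (fun s => nc (f s - f t)).
Proof.
move=> [[D1 _] [D2 _]].
by apply: tends0_complex; apply/differentiable_continuous/derivable1_diffP.
Qed.

Lemma cderivN (f : R -> C) t a : cderiv f t a -> cderiv (fun s => - f s) t (- a).
Proof.
move=> h; have := cderivM (cderiv_cst (-1) t) h; rewrite mul0r add0r mulN1r.
by congr cderiv; apply/funext => s; rewrite mulN1r.
Qed.

Lemma cderivB (f g : R -> C) t a b : cderiv f t a -> cderiv g t b -> cderiv (fun s => f s - g s) t (a - b).
Proof. by move=> hf hg; apply: cderivD => //; exact: cderivN. Qed.

(** The coordinatewise form of the equation follows from differentiability in L^2 and suffices for
    uniqueness in V(d). *)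
Definition szego_flow (u : R -> nat -> C) :=
  forall t k, cderiv (fun s => u s k) t (- 'i * szego_nl (u t) k).

Lemma nc_i : nc ('i : C) = 1.
Proof. by apply: complexI; rewrite -nc_norm normCi. Qed.

(* If [|u_k - v_k| <= D] for all [k] near [t0], then integrating the equation over a short time
   interval improves the bound to [D / 2]. *)
Lemma szego_local_unique d n (u v : R -> nat -> C) t0 : uphalf d = n.+1 ->
  (forall t, inVd d (u t)) -> (forall t, inVd d (v t)) ->
  szego_flow u -> szego_flow v -> u t0 = v t0 -> \forall t \near t0, u t = v t.
Proof.
move=> dn hu hv du dv uv.
have [K1 [q1 [K10 q10 q11 near1]]] := local_geodecay dn hu (fun k => cderiv_tends0 (du t0 k)).
have [K2 [q2 [K20 q20 q21 near2]]] := local_geodecay dn hv (fun k => cderiv_tends0 (dv t0 k)).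
pose K := Num.max K1 K2; pose q := Num.max q1 q2.
have K0 : 0 <= K by rewrite le_max K10.
have q0 : 0 < q by rewrite lt_max q10.
have q_1 : q < 1 by rewrite gt_max q11.
have bnd K' q' k : 0 <= K' -> 0 < q' -> K' <= K -> q' <= q -> K' * q' ^+ k <= K * q ^+ k.
  move=> k0 p0 *; apply: ler_pM => //; first by rewrite exprn_ge0// ltW.
  by rewrite lerXn2r// nnegrE ltW.
have [L L0 hL] := szego_lipschitz dn K0 q0 q_1.
have [eta0 eta00 hnear] : exists2 e : R, 0 < e & forall t, `|t - t0| < e ->
    (forall k, nc (u t k) <= K * q ^+ k) /\ (forall k, nc (v t k) <= K * q ^+ k).
  have [e /= e0 he] := (nbhs_ballP t0 _).1 (filterI near1 near2).
  exists e => // t; rewrite distrC => /he[h1 h2]; split=> k.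
    by rewrite (le_trans (h1 k))// bnd// le_max lexx.
  by rewrite (le_trans (h2 k))// bnd// le_max lexx orbT.
(* This length leaves at most [D / 4] for each of the real and imaginary parts. *)
pose eta := Num.min eta0 (4 * (L + 1))^-1.
have L1 : 0 < 4 * (L + 1) by rewrite mulr_gt0// ltr_wpDl.
have eta_gt0 : 0 < eta by rewrite lt_min eta00 invr_gt0.
have eta_le : eta <= eta0 by rewrite ge_min lexx.
have claim j t : `|t - t0| < eta -> forall k, nc (u t k - v t k) <= 2 * K * 2^-1 ^+ j.
  elim: j t => [|j IH] t ht k.
    have [h1 h2] := hnear t (lt_le_trans ht eta_le).
    rewrite expr0 mulr1 (le_trans (ncB _ _))// (_ : 2 * K = K + K); last by ring.
    have qk : K * q ^+ k <= K by rewrite ler_piMr// exprn_ile1// ltW.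
    by rewrite lerD// (le_trans _ qk).
  pose D := 2 * K * 2^-1 ^+ j.
  have D0 : 0 <= D by rewrite !mulr_ge0// exprn_ge0// invr_ge0.
  pose w s := u s k - v s k.
  have dw s : cderiv w s (- 'i * szego_nl (u s) k - - 'i * szego_nl (v s) k) by exact: cderivB.
  have bw s : `|s - t0| < eta -> nc (- 'i * szego_nl (u s) k - - 'i * szego_nl (v s) k) <= L * D.
    move=> hs; rewrite -mulrBr ncM ncN nc_i mul1r.
    have [h1 h2] := hnear s (lt_le_trans hs eta_le).
    exact: (hL (u s) (v s) D D0 (hu s) (hv s) h1 h2 (IH s hs)).
  have w0 : w t0 = 0 by rewrite /w uv subrr.
  have hRe := mvt_bound (fun s => (dw s).1) (fun s hs => le_trans (nc_Re _) (bw s hs)) ht.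
  have hIm := mvt_bound (fun s => (dw s).2) (fun s hs => le_trans (nc_Im _) (bw s hs)) ht.
  rewrite w0 /= !subr0 in hRe hIm.
  rewrite (le_trans (nc_le_ReIm _))// (le_trans (lerD hRe hIm))//.
  have ht' : `|t - t0| <= (4 * (L + 1))^-1 by rewrite ltW// (lt_le_trans ht)// ge_min lexx orbT.
  have -> : 2 * K * 2^-1 ^+ j.+1 = 2^-1 * D by rewrite exprS mulrCA.
  have LL : L * (4 * (L + 1))^-1 <= 4^-1.
    by rewrite invfM mulrCA ler_piMr ?invr_ge0// ler_pdivrMr ?ltr_wpDl// mul1r lerDl.
  have : L * D * `|t - t0| <= 4^-1 * D.
    rewrite mulrAC ler_wpM2r// (le_trans _ LL)// ler_wpM2l//.
  have aux (z1 z2 : R) : z1 <= 4^-1 * z2 -> z1 + z1 <= 2^-1 * z2 by move=> ?; lra.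
  exact: aux.
apply: (nbhs_ballP t0 _).2; exists eta => // t; rewrite /ball /= distrC => ht.
apply/funext => k; apply/eqP; rewrite -subr_eq0 -nc_eq0 eq_le nc_ge0 andbT.
have g : geodecay (fun j => 2 * K * 2^-1 ^+ j).
  by exists (2 * K), 2^-1; split; rewrite ?mulr_ge0 ?invr_gt0 ?invf_lt1 ?ltr1n.
by apply: (geodecay_le0 g) => j; exact: claim.
Qed.

(** Connectedness of the line: the indicator of the times at which the flows differ is locally
    constant, by local uniqueness where they agree and by continuity of a separating coordinate
    elsewhere. *)
Lemma szego_unique d n (u v : R -> nat -> C) : uphalf d = n.+1 ->
  (forall t, inVd d (u t)) -> (forall t, inVd d (v t)) ->
  szego_flow u -> szego_flow v -> u 0 = v 0 -> forall t, u t = v t.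
Proof.
move=> dn hu hv du dv uv t.
pose f s : R := if pselect (u s = v s) then 0 else 1.
suff : f t = f 0.
  by rewrite /f; case: pselect => //; case: pselect => // _ _ /eqP; rewrite oner_eq0.
apply: is_derive_0_is_cst => s.
apply: (@near_eq_is_derive _ _ _ (cst (f s))); rewrite ?oner_eq0//.
have [e|ne] := pselect (u s = v s).
  have := szego_local_unique dn hu hv du dv e; apply: filterS => r er.
  by rewrite /f /cst; case: pselect => //; case: pselect.
have [k nk] : exists k, u s k <> v s k.
  by apply: contrapT => h; apply: ne; apply/funext => k; apply: contrapT => hk; apply: h; exists k.
have w0 : 0 < nc (u s k - v s k).
  by rewrite lt_def nc_ge0 andbT nc_eq0 subr_eq0; apply/eqP.
have := tends0_near (cderiv_tends0 (cderivB (du s k) (dv s k))) w0.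
apply: filterS => r hr; rewrite /f /cst; case: (pselect (u s = v s)) => [es|ns]; first by case: ne.
case: (pselect (u r = v r)) => [er|//].
by exfalso; move: hr; rewrite er subrr sub0r ncN ltxx.
Qed.

End Uniqueness.

(** * Bounds on compact tori *)

Section SolutionFlow.
Local Open Scope classical_set_scope.
Variable R : realType.
Local Notation C := R[i].

Lemma l2dist2_coord (f g : nat -> C) k (e : R) :
  (l2dist2 f g < (e ^+ 2)%:E)%E -> 0 < e -> nc (f k - g k) < e.
Proof.
move=> h e0; rewrite -(@ltr_pXn2r _ 2) ?nnegrE ?nc_ge0 ?ltW// -lte_fin.
apply: le_lt_trans h; rewrite /l2dist2.
have h0 i : xpredT i -> (0 <= ((nc (f i - g i)) ^+ 2)%:E)%E.
  by move=> _; rewrite lee_fin exprn_ge0// nc_ge0.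
apply: le_trans (nneseries_lim_ge k.+1 (fun i _ => h0 i)).
rewrite big_nat_recr//= leeDr// sume_ge0// => i _; exact: h0.
Qed.

Lemma is_derive_eps (f : R -> R) (t df : R) :
  (forall e, 0 < e -> exists2 delta, 0 < delta &
    forall h, h != 0 -> `|h| < delta -> `|h^-1 * (f (t + h) - f t) - df| < e) ->
  is_derive t (1 : R) f df.
Proof.
move=> H; have L : (fun h : R => h^-1 *: ((f \o shift t) (h *: 1) - f t)) @ 0^' --> df.
  apply/cvgrPdist_lt => e e0; have [delta d0 hd] := H e e0.
  apply: (nbhs_ballP (0 : R) _).2; exists delta => // h; rewrite /ball /= sub0r normrN => hh h0.
  by rewrite distrC [h *: 1]mulr1 [h + t]addrC; exact: hd.
by split; [apply/cvg_ex; exists df|apply: cvg_lim].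
Qed.

Lemma solution_flow (u : R -> nat -> C) : szego_solution u -> szego_flow u.
Proof.
move=> hu t k.
have key e : 0 < e -> exists2 delta : R, 0 < delta & forall h : R, h != 0 -> `|h| < delta ->
    nc ((u (t + h) k - u t k) / h%:C%C - (- 'i * szego_nl (u t) k)) < e.
  move=> e0; have [|delta d0 hd] := hu t (e ^+ 2); first by rewrite exprn_gt0.
  exists delta => // h h0 hh; exact: (l2dist2_coord k (hd h h0 hh) e0).
have divE (z : C) (h : R) : z / h%:C%C = Complex (h^-1 * complex.Re z) (h^-1 * complex.Im z).
  rewrite -fmorphV /=; case: z => z1 z2; apply/eqP; rewrite eq_complex /=.
  by apply/andP; split; apply/eqP; ring.
split; apply: is_derive_eps => e e0; have [delta d0 hd] := key e e0; exists delta => // h h0 hh.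
- apply: le_lt_trans (hd h h0 hh); apply: le_trans (nc_Re _); rewrite divE.
  by case: (u (t + h) k) (u t k) (- 'i * szego_nl (u t) k) => ? ? [? ?] [].
- apply: le_lt_trans (hd h h0 hh); apply: le_trans (nc_Im _); rewrite divE.
  by case: (u (t + h) k) (u t k) (- 'i * szego_nl (u t) k) => ? ? [? ?] [].
Qed.

End SolutionFlow.

Section SobolevBound.
Local Open Scope classical_set_scope.
Variable R : realType.
Local Notation C := R[i].

Lemma geodecay_poly (q : R) j : 0 < q -> q < 1 -> geodecay (fun k => k.+1%:R ^+ j * q ^+ k).
Proof.
move=> q0 q1; elim: j => [|j IH]; last first.
  by apply: geodecay_arith IH _ => k; rewrite exprS mulrA.
by exists 1, q; split=> // k; rewrite expr0.
Qed.

Lemma Hs_norm2_geometric (s K q : R) : 0 <= K -> 0 < q -> q < 1 ->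
  exists M : R, forall f : nat -> C, (forall k, nc (f k) <= K * q ^+ k) ->
    (Hs_norm2 s f <= M%:E)%E.
Proof.
(* As 1 + k^2 <= (k+1)^2, an integer [m] above [s] bounds the weight by (k+1)^(2m). *)
move=> K0 q0 q1; pose m := Num.bound (Num.max s 0).
have sm : s <= m%:R.
  have h : 0 <= Num.max s 0 by rewrite le_max lexx orbT.
  by rewrite (le_trans _ (ltW (archi_boundP h)))// le_max lexx.
have q20 : 0 < q ^+ 2 by rewrite exprn_gt0.
have q21 : q ^+ 2 < 1 by rewrite exprn_ilt1// ltW.
have [L [r [L0 r0 r1 hL]]] := geodecay_poly (m + m) q20 q21.
exists (K ^+ 2 * L * (1 - r)^-1) => f hf; rewrite /Hs_norm2.
have t0 k : (0 <= ((1 + k%:R ^+ 2) `^ s * nc (f k) ^+ 2)%:E)%E.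
  by rewrite lee_fin mulr_ge0 ?powR_ge0// exprn_ge0// nc_ge0.
apply: lime_le; first by apply: is_cvg_nneseries => k _ _; exact: t0.
near=> N; rewrite sumEFin lee_fin big_mkord.
apply: (@le_trans _ _ (\sum_(k < N) K ^+ 2 * L * r ^+ k)); last first.
  rewrite -mulr_sumr ler_wpM2l ?mulr_ge0 ?exprn_ge0//.
  exact: geometric_sum_le (ltW r0) r1.
apply: ler_sum => k _; rewrite -mulrA.
apply: le_trans (ler_wpM2l _ (hL k)); last by rewrite exprn_ge0.
have k1 : 1 <= 1 + k%:R ^+ 2 :> R by rewrite lerDl exprn_ge0.
have -> : K ^+ 2 * (k.+1%:R ^+ (m + m) * (q ^+ 2) ^+ k) =
    k.+1%:R ^+ (m + m) * (K * q ^+ k) ^+ 2.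
  by rewrite [(K * _) ^+ 2]exprMn -!exprM (mulnC 2 k) mulrCA.
apply: ler_pM; rewrite ?powR_ge0 ?exprn_ge0 ?nc_ge0//; last first.
  by rewrite lerXn2r ?nnegrE ?nc_ge0// mulr_ge0// exprn_ge0// ltW.
apply: le_trans (ler_powR k1 sm) _.
have k0 := le_trans ler01 k1.
rewrite powR_mulrn// addnn -mul2n exprM; apply: lerXn2r; rewrite ?nnegrE ?exprn_ge0//.
by rewrite -natr1 [leRHS]sqrrD expr1n mulr1 [leRHS]addrC addrA lerDl mulrn_wge0.
Unshelve. all: by end_near.
Qed.

End SobolevBound.

Section TorusCompact.
Local Open Scope classical_set_scope.
Variable R : realType.
Local Notation C := R[i].

Lemma periodic_int (f : R -> R) T (z : int) x : periodic f T -> f (x + T *~ z) = f x.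
Proof.
move=> hf; case: z => m; first exact: periodicn.
by rewrite NegzE mulrNz -(periodicn hf m.+1 (x + _)) addrNK.
Qed.

Lemma cis_box (x : R) : exists2 y, 0 <= y <= pi *+ 2 & cis y = cis x.
Proof.
have p0 : 0 < pi *+ 2 :> R by rewrite mulrn_wgt0// pi_gt0.
pose z := - Num.floor (x / (pi *+ 2)).
exists (x + (pi *+ 2) *~ z); last first.
  by rewrite /cis (periodic_int z x (@cosD2pi R)) (periodic_int z x (@sinD2pi R)).
rewrite /z mulrNz -mulrzr.
have := floor_itv (x / (pi *+ 2)).
rewrite ler_pdivlMr// ltr_pdivrMr// => /andP[h1 h2].
rewrite subr_ge0 mulrC h1 /= lerBlDr.
by move: h2; rewrite intrD mulrDl mul1r => /ltW; rewrite addrC.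
Qed.

Lemma ctrig_tends0 N (f : 'rV[R]_N -> C) x0 : ctrig f -> tends0 x0 (fun x => nc (f x - f x0)).
Proof.
by move=> [/trig_continuous/(_ x0) c1 /trig_continuous/(_ x0) c2]; exact: tends0_complex.
Qed.

(** Both constants are tied to one integer, [K = j + 1] and [q = 1 - 1/(j + 2)], and increase with
    it. Each local bound thus holds for all large [j], and compactness yields one [j] for the whole
    set. *)
Lemma compact_geodecay n d N (y : 'rV[R]_N -> nat -> C) (A : set 'rV[R]_N) :
  uphalf d = n.+1 -> (forall x, inVd d (y x)) ->
  (forall x0 k, tends0 x0 (fun x => nc (y x k - y x0 k))) -> compact A ->
  exists K q : R, [/\ 0 <= K, 0 < q, q < 1 &
    forall x, A x -> forall k, nc (y x k) <= K * q ^+ k].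
Proof.
move=> dn hy cy /compact_near_coveringP cA.
pose P (j : nat) x := forall k, nc (y x k) <= j.+1%:R * (1 - (j.+2%:R)^-1) ^+ k.
have q0 j : 0 < 1 - (j.+2%:R)^-1 :> R by rewrite subr_gt0 invf_lt1 ?ltr0n// ltr1n.
have [|j _ hj] := cA nat \oo P _.
  move=> x0 _; have [K [q [K0 q00 q1 hn]]] := local_geodecay dn hy (cy x0).
  pose j0 := maxn (Num.bound K) (Num.bound (1 - q)^-1).
  have q1' : 0 < 1 - q by rewrite subr_gt0.
  exists ([set x | forall k, nc (y x k) <= K * q ^+ k], [set j | (j0 <= j)%N]).
    by split=> //=; exists j0.
  move=> [x j] /= [hx hj] k; apply: le_trans (hx k) _.
  apply: ler_pM => //; first by rewrite exprn_ge0// ltW.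
    rewrite (le_trans (ltW (archi_boundP K0)))// ler_nat leqW// (leq_trans _ hj)//.
    exact: leq_maxl.
  rewrite lerXn2r ?nnegrE ?(ltW (q0 j)) ?(ltW q00)//.
  rewrite lerBrDl addrC -lerBrDl -[leRHS]invrK lef_pV2 ?posrE ?invr_gt0//.
  have i0 : 0 <= (1 - q)^-1 by rewrite invr_ge0 ltW.
  rewrite (le_trans (ltW (archi_boundP i0)))// ler_nat !leqW// (leq_trans _ hj)//.
  exact: leq_maxr.
exists j.+1%:R, (1 - (j.+2%:R)^-1); split; [by []|exact: q0|by rewrite gtrBl invr_gt0|].
by move=> x Ax k; apply: (hj j (leqnn _)).
Qed.

End TorusCompact.

Theorem theorem2 (R : realType) (d : nat) (u0 : nat -> R[i]) (u : R -> nat -> R[i]) :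
  (0 < d)%N -> inVd d u0 ->
  u 0 = u0 -> (forall t : R, inVd d (u t)) -> szego_solution u ->
  (exists (n : nat) (omega : 'rV[R]_n) (Phi : 'rV[R]_n -> nat -> R[i]),
      [/\ (0 < n)%N, smooth_torus_map_Vd d Phi &
          forall t : R, u t = Phi (t *: omega)]) /\
  (forall s : R, 1 / 2 < s ->
      exists M : R, forall t : R, (Hs_norm2 s (u t) <= M%:E)%E).
Proof.
move=> d0 hu0 u00 hu usol.
have [n dn] : exists n, uphalf d = n.+1 by case: d d0 {hu0 hu} => // d _; exists d./2.
have [A [B h]] := hu0; have [_ sB _] := Vd_size h.
have Hu := Vd_hankel h; have B0 : B`_0 = 1 by case: h.
have hB l : (n.+1 <= l)%N -> pconv B u0 l = 0 by rewrite -dn; exact: Vd_recurrence h.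
rewrite dn in sB Hu.
have [T [P [b [c [bal sT Tu E]]]]] := balanced_realization Hu sB B0 hB (Vd_geodecay hu0).
have Td : (T \in unitmx) = ~~ odd d by rewrite Tu -dn (Vd_hankel1 hu0).
have Ph : P^t* = P by case: bal => _ _ [].
have Qh : (P - b^t* *m b)^t* = P - b^t* *m b by rewrite adjmxB adjmxM trmxCK Ph.
have [S1 [p [S1u PE]]] := hermitian_spectral Ph.
have [S2 [q [S2u QE]]] := hermitian_spectral Qh.
pose Phi := torus_map T b c S1 S2 p q.
pose om := frequencies p q.
have PhiVd theta : inVd d (Phi theta).
  by have hV := torus_Vd bal sT S1u S2u PE QE theta dn Td; exists (impulse_num (torus_T T S1 S2 p q theta) (torus_b b S1 p theta) c), (rev_char (torus_T T S1 S2 p q theta)).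
(* At zero angles both rotations are the identity. *)
have Phi0 : Phi 0 = u0.
  apply/funext => k; rewrite E /Phi /torus_map /torus_T /torus_b.
  have one S (D : 'rV[R[i]]_n.+1) f : S \is unitarymx -> (forall z, f z = 1) ->
      spectral_fun S D f = 1%:M.
    move=> Su f1; rewrite /spectral_fun (_ : \row__ _ = const_mx 1); last first.
      by apply/rowP => j; rewrite !mxE f1.
    by rewrite diag_const_mx mulmx1 unitarymx_adjK.
  have cis0 : cis 0 = 1 :> R[i] by rewrite /cis cos0 sin0.
  by rewrite /rotU /rotV !one ?mulmx1// => z; rewrite mxE ?oppr0 cis0.
have uPhi t : u t = Phi (t *: om).
  move: t; apply: (szego_unique dn hu) => [t|||]; first exact: PhiVd.
  - exact: solution_flow.
  - move=> t k; rewrite /Phi (szego_nl_impulse k (torus_balanced bal S1u S2u PE QE _)); last first.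
      exact: (torus_stable bal sT S1u S2u PE QE (t *: om) dn Td).
    exact: (torus_ode bal S1u S2u PE QE t k).
  - by rewrite u00 scale0r Phi0.
split.
  exists (n.+1 + n.+1)%N, om, Phi; split; [by []| |exact: uPhi].
  split; first by move=> theta j; exact: torus_periodic.
  exists (fun theta => impulse_num (torus_T T S1 S2 p q theta) (torus_b b S1 p theta) c).
  exists (fun theta => rev_char (torus_T T S1 S2 p q theta)).
  split; first by move=> theta; exact: (torus_Vd bal sT S1u S2u PE QE theta dn Td).
  move=> k; split; apply: ctrig_smooth.
    exact: (polytrig_impulse_num c (mxtrig_torus_T T S1 S2 p q) (mxtrig_torus_b b S1 p) k).
  exact: (polytrig_rev_char (mxtrig_torus_T T S1 S2 p q) k).
move=> s _.
pose box := [set v : 'rV[R]_(n.+1 + n.+1) | forall i, `[0, pi *+ 2]%classic (v ord0 i)]%classic.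
have cbox : compact box.
  by apply: (@rV_compact R _ (fun=> `[0, pi *+ 2]%classic)) => i; exact: segment_compact.
have [|K [r [K0 r0 r1 hK]]] := compact_geodecay dn PhiVd _ cbox.
  move=> x0 k; exact: (ctrig_tends0 x0 (torus_coord_trig T b c S1 S2 p q k)).
have [M hM] := Hs_norm2_geometric s K0 r0 r1.
exists M => t; apply: hM => k; rewrite uPhi.
(* The angles are reduced modulo 2 pi to the compact box on which the decay is uniform; [Phi] sees
   them only through [cis]. *)
pose theta : 'rV[R]_(n.+1 + n.+1) := \row_j s2val (cid2 (cis_box ((t *: om) 0 j))).
have -> : Phi (t *: om) = Phi theta.
  by apply: torus_map_cis => j; rewrite [theta 0 j]mxE; case: cid2.
apply: hK => j; rewrite mxE /= in_itv /=; case: cid2 => //.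
Qed.
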